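(* Let $w$ be a nowhere-zero weight function on an interval with left endpoint $a$, and let $M_{w(x)}$ be the multiplication operator $(M_{w(x)}f)(x)=w(x)f(x)$. Then the weighted fractional differintegrals are conjugations of the original fractional differintegrals, i.e., as operators acting on the functions for which they are defined, \begin{align*} {}^{RL}_{a}I^{\alpha}_{x;w(x)}&= M_{w(x)}^{-1}\circ{}^{RL}_{a}I^{\alpha}_x\circ M_{w(x)}\qquad(\mathrm{Re}(\alpha)>0),\\ {}^{RL}_{a}D^{\alpha}_{x;w(x)}&= M_{w(x)}^{-1}\circ{}^{RL}_{a}D^{\alpha}_x\circ M_{w(x)}\qquad(\mathrm{Re}(\alpha)\ge 0),\\ {}^{C}_{a}D^{\alpha}_{x;w(x)}&= M_{w(x)}^{-1}\circ{}^{C}_{a}D^{\alpha}_x\circ M_{w(x)}\qquad(\mathrm{Re}(\alpha)\ge 0). \end{align*}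
   Context: Let $a<b$, $\alpha\in\mathbb{C}$. $AC^n$ denotes functions whose $(n-1)$-th derivative is absolutely continuous on the interval. For $\mathrm{Re}(\alpha)\ge0$ put $n:=\lfloor\mathrm{Re}(\alpha)\rfloor+1$. Classical (unweighted) operators: for $f\in L^1(a,b)$ and $\mathrm{Re}(\alpha)>0$, ${}^{RL}_{a}I^{\alpha}_xf(x)=\frac{1}{\Gamma(\alpha)}\int_a^x(x-t)^{\alpha-1}f(t)\,dt$; for $\mathrm{Re}(\alpha)\geq0$ and $f\in AC^n(a,b)$, ${}^{RL}_{a}D^{\alpha}_xf(x)=\frac{d^n}{dx^n}\big({}^{RL}_{a}I^{n-\alpha}_xf(x)\big)$ and ${}^{C}_{a}D^{\alpha}_xf(x)={}^{RL}_{a}I^{n-\alpha}_x\big(\frac{d^n}{dx^n}f(x)\big)$. Weighted operators: for $f\in L^1(a,b)$, $w\in L^\infty(a,b)$, $\mathrm{Re}(\alpha)>0$, $${}^{RL}_{a}I^{\alpha}_{x;w(x)}f(x)=\frac{1}{\Gamma(\alpha)w(x)}\int_a^x(x-t)^{\alpha-1}w(t)f(t)\,dt,\quad x\in(a,b);$$ for $\mathrm{Re}(\alpha)\ge0$, $f\in AC^n(a,b)$, $w\in AC^n[a,b]$, $${}^{RL}_{a}D^{\alpha}_{x;w(x)}f(x)=\left(\frac{d}{dx}+\frac{w'(x)}{w(x)}\right)^n{}^{RL}_{a}I^{n-\alpha}_{x;w(x)}f(x);$$ for $\mathrm{Re}(\alpha)\ge0$, $f\in C^n(a,b)$, $w\in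 C^n[a,b]$, $${}^{C}_{a}D^{\alpha}_{x;w(x)}f(x)={}^{RL}_{a}I^{n-\alpha}_{x;w(x)}\left(\frac{d}{dx}+\frac{w'(x)}{w(x)}\right)^nf(x).$$ Here $w$ is nowhere zero, so that $1/w$ makes sense. *)

(* Defs.v *)
From mathcomp Require Import all_boot all_order all_algebra.
From mathcomp Require Import all_classical all_reals all_analysis.
From mathcomp Require Import complex.

Set Implicit Arguments.
Unset Strict Implicit.
Unset Printing Implicit Defensive.

Import Order.TTheory GRing.Theory Num.Theory.
Import numFieldNormedType.Exports.

Local Open Scope classical_set_scope.
Local Open Scope ring_scope.
Local Open Scope complex_scope.

Section ComplexValued.
Context {R : realType}.
Implicit Types (f g w : R -> R[i]) (A D : set R).

(* Functions R -> R[i] are differentiated and integrated componentwise. *)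

Definition fRe f : R -> R := fun x => complex.Re (f x).
Definition fIm f : R -> R := fun x => complex.Im (f x).

Definition derC f : R -> R[i] := fun x => derive1 (fRe f) x +i* derive1 (fIm f) x.

Definition intC D f : R[i] :=
  (\int[lebesgue_measure]_(t in D) fRe f t) +i*
  (\int[lebesgue_measure]_(t in D) fIm f t).

(* r ^ z = exp (z * ln r), meaningful for 0 < r. *)
Definition powC (r : R) (z : R[i]) : R[i] :=
  (r `^ complex.Re z)%:C *
  (cos (complex.Im z * ln r) +i* sin (complex.Im z * ln r)).

(* Euler's integral, meaningful for 0 < Re z. *)
Definition GammaC (z : R[i]) : R[i] :=
  intC `]0, +oo[ (fun t => powC t (z - 1) * (expR (- t))%:C).

End ComplexValued.

Section FunctionSpaces.
Context {R : realType}.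
Implicit Types (A : set R) (n : nat).

Definition L1C A (f : R -> R[i]) : Prop :=
  lebesgue_measure.-integrable A (EFin \o fRe f) /\
  lebesgue_measure.-integrable A (EFin \o fIm f).

Definition LinftyC A (f : R -> R[i]) : Prop :=
  [/\ measurable_fun A (fRe f), measurable_fun A (fIm f) &
    exists M : R, {ae lebesgue_measure, forall x, A x -> `|f x| <= M%:C}].

(* g is the derivative of f on the interval A; at an endpoint belonging to A
   this is the one-sided derivative. *)
Definition has_deriv_on A (f g : R -> R) : Prop :=
  forall x, A x ->
    (fun y => (f y - f x) / (y - x)) @ within A x^' --> g x.

(* d 0, ..., d n are the successive derivatives of f on A. *)
Definition derivs_on A n (f : R -> R) (d : nat -> R -> R) : Prop :=
  (forall x, A x -> d 0%N x = f x) /\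
  (forall k, (k < n)%N -> has_deriv_on A (d k) (d k.+1)).

Definition abs_cont A (f : R -> R) : Prop :=
  forall e : R, 0 < e -> exists2 delta : R, 0 < delta &
    forall (m : nat) (s t : 'I_m -> R),
      (forall i, s i < t i /\ `[s i, t i] `<=` A) ->
      trivIset setT (fun i => `]s i, t i[%classic) ->
      \sum_(i < m) (t i - s i) < delta ->
      \sum_(i < m) `|f (t i) - f (s i)| < e.

Definition CnR n A (f : R -> R) : Prop :=
  exists2 d, derivs_on A n f d & {within A, continuous (d n)}.

(* Used for 0 < n only. *)
Definition ACnR n A (f : R -> R) : Prop :=
  exists2 d, derivs_on A n.-1 f d & abs_cont A (d n.-1).

Definition CnC n A (f : R -> R[i]) : Prop :=
  CnR n A (fRe f) /\ CnR n A (fIm f).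

Definition ACnC n A (f : R -> R[i]) : Prop :=
  ACnR n A (fRe f) /\ ACnR n A (fIm f).

End FunctionSpaces.

Section Operators.
Context {R : realType}.
Implicit Types (a : R) (alpha : R[i]) (w f : R -> R[i]).

Definition mulop w f : R -> R[i] := fun x => w x * f x.

Definition mulop_inv w f : R -> R[i] := fun x => (w x)^-1 * f x.

(* floor (Re alpha) + 1, for 0 <= Re alpha. *)
Definition frac_ord alpha : nat := (Num.truncn (complex.Re alpha)).+1.

Definition RLint a alpha f : R -> R[i] := fun x =>
  (GammaC alpha)^-1 *
  intC `]a, x[ (fun t => powC (x - t) (alpha - 1) * f t).

Definition RLder a alpha f : R -> R[i] :=
  let n := frac_ord alpha in iter n derC (RLint a (n%:R - alpha) f).

Definition Cder a alpha f : R -> R[i] :=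
  let n := frac_ord alpha in RLint a (n%:R - alpha) (iter n derC f).

Definition wRLint a alpha w f : R -> R[i] := fun x =>
  (GammaC alpha * w x)^-1 *
  intC `]a, x[ (fun t => powC (x - t) (alpha - 1) * w t * f t).

(* The operator d/dx + w'/w. *)
Definition wdiff w f : R -> R[i] := fun x => derC f x + derC w x / w x * f x.

Definition wRLder a alpha w f : R -> R[i] :=
  let n := frac_ord alpha in
  iter n (wdiff w) (wRLint a (n%:R - alpha) w f).

Definition wCder a alpha w f : R -> R[i] :=
  let n := frac_ord alpha in
  wRLint a (n%:R - alpha) w (iter n (wdiff w) f).

End Operators.

(* Main.v *)
(* Write D for d/dx and M for multiplication by w.  The product rule reads
   D (w g) = w (D + w'/w) g, so by iteration (D + w'/w)^n = M^-1 D^n M wherever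
   the derivatives exist; the integral formula holds by inspection, and the
   Caputo formula because w f is n times differentiable on ]a, b[.

   For the Riemann-Liouville derivative one must show that the fractional
   integral of h = w f, of order beta = n - alpha with 0 < Re beta <= 1, is
   n - 1 times differentiable on ]a, b[ with (n-1)-st derivative differentiable
   almost everywhere.  An absolutely continuous h has the form
   h(x) = c + int_a^x g with g integrable (Radon-Nikodym applied to the Stieltjes
   measures of its monotone parts), and for the kernel
   k(r) = r^(beta - 1), integrable near 0, Fubini's theorem gives
     int_a^x k(x-t) h(t) dt
       = int_a^x (c k(u-a) + int_a^u k(u-s) g(s) ds) du.
   If h is merely absolutely continuous, Lebesgue's differentiation theorem
   concludes; otherwise g = h', the integrand is continuous, and one proceeds by
   induction on n.  Almost everywhere differentiability of w itself matters for
   n = 1, where w is only absolutely continuous. *)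

Require Import Defs.
From HB Require Import structures.
From mathcomp Require Import all_boot all_order all_algebra.
From mathcomp Require Import all_classical all_reals all_analysis measurable_realfun.
From mathcomp Require Import complex ring lra.

Set Implicit Arguments.
Unset Strict Implicit.

Import Order.TTheory GRing.Theory Num.Theory.
Import numFieldNormedType.Exports.

Local Open Scope classical_set_scope.
Local Open Scope ring_scope.
Local Open Scope complex_scope.

(** * Absolutely continuous functions *)

Section AbsCont.
Context {R : realType}.
Implicit Types (A : set R) (f g h : R -> R) (a b : R).

(** Degenerate intervals contribute zero to both sums, so they are discarded and the remaining
    indices enumerated. Later uses may then take any finite index type and weak inequalities. *)
Lemma abs_cont_sum A h e : abs_cont A h -> 0 < e ->
  exists2 d, 0 < d & forall (T : finType) (P : pred T) (s t : T -> R),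
    (forall i, P i -> s i <= t i /\ `[s i, t i] `<=` A) ->
    trivIset [set i | P i] (fun i => `]s i, t i[%classic) ->
    \sum_(i | P i) (t i - s i) < d ->
    \sum_(i | P i) `|h (t i) - h (s i)| < e.
Proof.
move=> hA e0; have [d d0 hd] := hA e e0; exists d => // T P s t st tr.
pose Q := [pred i | P i && (s i < t i)].
have red (F : T -> R) : (forall i, s i = t i -> F i = 0) ->
    \sum_(i | P i) F i = \sum_(j < #|Q|) F (enum_val j).
  move=> F0; rewrite -(big_enum_val (A := Q) F) [LHS](bigID (fun i => s i < t i))/=.
  rewrite [X in _ + X]big1 ?addr0// => i /andP[Pi]; rewrite -leNgt => ts.
  by apply: F0; apply/eqP; rewrite eq_le ts (st _ Pi).1.
rewrite (red (fun i => t i - s i)); last by move=> i ->; rewrite subrr.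
rewrite (red (fun i => `|h (t i) - h (s i)|)); last first.
  by move=> i ->; rewrite subrr normr0.
apply: hd => [j|].
  by have /andP[Pj sj] : Q (enum_val j) := enum_valP j; split=> //; exact: (st _ Pj).2.
move=> i j _ _ ij; apply: enum_val_inj; apply: tr => //=.
- by have /andP[] : Q (enum_val i) := enum_valP i.
- by have /andP[] : Q (enum_val j) := enum_valP j.
Qed.

Lemma abs_cont_unif A h e : abs_cont A h -> 0 < e ->
  exists2 d, 0 < d & forall x y, x <= y -> `[x, y] `<=` A -> y - x < d ->
    `|h y - h x| < e.
Proof.
move=> hA e0; have [d d0 hd] := abs_cont_sum hA e0; exists d => // x y xy xyA yxd.
have := hd unit xpredT (fun=> x) (fun=> y).
rewrite !big_const !card_unit/= !addr0; apply => //.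
by move=> [] [].
Qed.

Lemma abs_cont_dominated A (f g h : R -> R) (C : R) : abs_cont A f -> abs_cont A g ->
  (forall x y, A x -> A y ->
    `|h y - h x| <= C * (`|f y - f x| + `|g y - g x|)) ->
  abs_cont A h.
Proof.
(* [C1] is a positive majorant of [C], whatever the sign of [C], so that division by it is
   legitimate. *)
move=> fA gA hfg e e0; pose C1 := `|C| + 1.
have C10 : 0 < C1 by rewrite ltr_wpDl.
have e20 : 0 < e / C1 / 2 by rewrite !divr_gt0.
have [d1 d10 hd1] := fA _ e20; have [d2 d20 hd2] := gA _ e20.
exists (Num.min d1 d2) => [|m s t st tr]; first by rewrite lt_min d10.
rewrite lt_min => /andP[std1 std2].
have h1 := hd1 m s t st tr std1; have h2 := hd2 m s t st tr std2.
apply: (@le_lt_trans _ _ (C1 * (\sum_(i < m) `|f (t i) - f (s i)| +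
                                \sum_(i < m) `|g (t i) - g (s i)|))).
  rewrite -big_split/= mulr_sumr; apply: ler_sum => i _.
  have [sti stA] := st i; apply: le_trans (hfg _ _ _ _) _.
  - by apply: stA; rewrite /= in_itv/= lexx ltW.
  - by apply: stA; rewrite /= in_itv/= lexx ltW.
  - by rewrite ler_wpM2r ?addr_ge0// /C1 (le_trans (ler_norm _))// lerDl.
by rewrite -ltr_pdivlMl// mulrC; lra.
Qed.

(** For small [e] this projects the line onto [[a + e, b - e]], so that [h] is evaluated strictly
    inside []a, b[]. The extension of [h] is the limit as [e] tends to 0 from the right. *)
Let clamp a b (e x : R) : R := Num.max (a + e) (Num.min (b - e) x).

Let clamp_itv a b e x : 0 < e -> e < (b - a) / 2 -> a < clamp a b e x < b.
Proof.
move=> e0 eab; rewrite /clamp lt_max gt_max gt_min ltrDl e0/= ltrBlDr ltrDl e0/= andbT; lra.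
Qed.

Let clampP a b e x : e < (b - a) / 2 ->
  [\/ x <= a + e /\ clamp a b e x = a + e,
      b - e <= x /\ clamp a b e x = b - e |
      a + e <= x <= b - e /\ clamp a b e x = x].
Proof.
move=> eab; rewrite /clamp.
have [h|h] := leP (b - e) x.
  by rewrite (max_idPr _); [constructor 2|lra].
have [h2|h2] := leP (a + e) x; first by constructor 3; split => //; lra.
by constructor 1; split => //; lra.
Qed.

Let clamp_contract a b e x y : e < (b - a) / 2 -> x <= y ->
  clamp a b e y - clamp a b e x <= y - x.
Proof.
move=> eab xy.
by case: (clampP y eab) => -[? ->]; case: (clampP x eab) => -[? ->]; lra.
Qed.

Let clamp_between a b e x y z : e < (b - a) / 2 -> x <= y ->
  clamp a b e x < z < clamp a b e y -> x < z < y.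
Proof.
move=> eab xy.
by case: (clampP y eab) => -[? ->]; case: (clampP x eab) => -[? ->]; lra.
Qed.

Let clamp_dist a b m n d x : 0 < m < d -> 0 < n < d ->
  m < (b - a) / 2 -> n < (b - a) / 2 ->
  `|clamp a b n x - clamp a b m x| < d.
Proof.
move=> md nd mab nab; rewrite ltr_norml.
by case: (clampP x nab) => -[? ->]; case: (clampP x mab) => -[? ->]; lra.
Qed.

(** Uniform continuity makes [h (clamp a b e x)] Cauchy as [e] tends to 0. Each projection is
    contracting and keeps disjoint intervals disjoint, so the modulus of absolute continuity
    survives in the limit; at an interior point the projection is eventually the identity. *)
Lemma abs_cont_extend a b h : a < b -> abs_cont `]a, b[ h ->
  exists2 H : R -> R, abs_cont setT H & {in `]a, b[, h =1 H}.
Proof.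
move=> ab hac.
have sub x y : a < x -> y < b -> `[x, y] `<=` `]a, b[.
  by move=> ax yb; apply: subset_itvSoo; rewrite bnd_simp.
have cvgh x : cvg (h (clamp a b e x) @[e --> 0^'+]).
  apply: cauchy_cvg; apply: cauchy_exP => e e0.
  have [d d0 hd] := abs_cont_unif hac e0.
  (* Two parameters below [d'] move the projected point by less than [d], and both truncated
     intervals are nonempty. *)
  pose d' := Num.min d ((b - a) / 2).
  have d'0 : 0 < d' by rewrite /d' lt_min d0/=; lra.
  pose n := d' / 2.
  have hn : 0 < n < d' by rewrite /n; lra.
  exists (h (clamp a b n x)); rewrite /fmap/=; near=> m.
  have hm : 0 < m < d' by apply/andP; split => //; near: m; exact: nbhs_right_lt.
  rewrite /ball/=.
  have [hnd hnab] : n < d /\ n < (b - a) / 2.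
    by move: hn => /andP[_]; rewrite /d' lt_min => /andP[].
  have [hmd hmab] : m < d /\ m < (b - a) / 2.
    by move: hm => /andP[_]; rewrite /d' lt_min => /andP[].
  have [n0 m0] : 0 < n /\ 0 < m by move: hn hm => /andP[? _] /andP[? _].
  have /andP[cn1 cn2] := clamp_itv (x) n0 hnab.
  have /andP[cm1 cm2] := clamp_itv (x) m0 hmab.
  have : `|clamp a b n x - clamp a b m x| < d.
    by apply: clamp_dist; rewrite ?m0 ?n0.
  have [cnm|cmn] := leP (clamp a b n x) (clamp a b m x).
    rewrite distrC ger0_norm ?subr_ge0// distrC.
    by apply: hd => //; exact: sub.
  rewrite ger0_norm ?subr_ge0 ?ltW//.
  by apply: hd => //; [exact: ltW|exact: sub].
pose H x := lim (h (clamp a b e x) @[e --> 0^'+]).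
exists H.
  move=> e e0; have e20 : 0 < e / 2 by lra.
  have [d d0 hd] := abs_cont_sum hac e20; exists d => // m s t st tr std.
  (* The limit preserves only weak inequalities, hence the half. *)
  apply: (@le_lt_trans _ _ (e / 2)); last by lra.
  have cvgS : \sum_(i < m) `|h (clamp a b n (t i)) - h (clamp a b n (s i))| @[n --> 0^'+] -->
      \sum_(i < m) `|H (t i) - H (s i)|.
    apply: cvg_big => [|i _]; first exact: add_continuous.
    by apply: cvg_norm; apply: cvgB; exact: cvgh.
  rewrite -(cvg_lim _ cvgS)//; apply: limr_le; first exact: cvgP cvgS.
  near=> n; apply/ltW/hd.
  - move=> i _; have [sti _] := st i.
    have nab : n < (b - a) / 2 by near: n; apply: nbhs_right_lt; lra.
    have cc : clamp a b n (s i) <= clamp a b n (t i).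
      by rewrite /clamp; apply: le_max2; rewrite ?le_min2// ltW.
    split => //; have n0 : 0 < n by [].
    by apply: sub; [have /andP[] := clamp_itv (s i) n0 nab
                   |have /andP[] := clamp_itv (t i) n0 nab].
  - have nab : n < (b - a) / 2 by near: n; apply: nbhs_right_lt; lra.
    move=> i j _ _ [y [/= h1 h2]]; apply: tr => //; exists y.
    by split; rewrite /= in_itv/=; apply: (clamp_between nab); rewrite ?(itvP h1) ?(itvP h2)//;
      exact: ltW (st _).1.
  - apply: (le_lt_trans _ std); apply: ler_sum => i _.
    apply: clamp_contract; last exact: ltW (st i).1.
    by near: n; apply: nbhs_right_lt; lra.
move=> x; rewrite in_itv/= => /andP[ax xb]; rewrite /H; apply/esym/cvg_lim => //.
apply: cvg_near_cst; near=> n.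
have nab : n < (b - a) / 2 by near: n; apply: nbhs_right_lt; lra.
have na : n < x - a by near: n; apply: nbhs_right_lt; lra.
have nb : n < b - x by near: n; apply: nbhs_right_lt; lra.
by case: (clampP x nab) => -[? ->]//; exfalso; lra.
Unshelve. all: by end_near. Qed.


End AbsCont.

(** * Densities of nondecreasing absolutely continuous functions *)

Section Density.
Context {R : realType}.
Implicit Types (G f g h : R -> R) (a b : R).
Notation mu := (@lebesgue_measure R).

Lemma abs_cont_continuous G : abs_cont setT G -> continuous G.
Proof.
move=> GT x; apply/cvgrPdist_lt => e e0.
have [d d0 hd] := abs_cont_unif GT e0; near=> y.
have yxd : `|x - y| < d by near: y; exact: cvgr_dist_lt.
have [xy|yx] := leP x y.
  by rewrite distrC; apply: hd => //; apply: le_lt_trans yxd; rewrite distrC ler_norm.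
by apply: hd => //; [exact: ltW|apply: le_lt_trans yxd; rewrite ler_norm].
Unshelve. all: by end_near. Qed.

(** Serves for the components of an open set of finite measure; the empty interval is represented
    with [s = t]. *)
Lemma open_finite_itv (I : set R) : open I -> is_interval I -> (mu I < +oo)%E ->
  exists s t : R, s <= t /\ I = `]s, t[%classic.
Proof.
move=> /interior_id oI itI; have : [set` Rhull I] = I by apply: RhullK; rewrite inE.
case: (Rhull I) => [[bl l|[|]] [br r|[|]]] IE; rewrite -IE.
- move=> _; move: oI; rewrite -IE interior_itv_bnd => <-.
  have [lr|rl] := leP l r; first by exists l, r.
  by exists l, l; rewrite !set_itv_ge// bnd_simp -?leNgt//; exact: ltW.
- by move=> _; exists 0, 0; rewrite !set_itvE.
- by rewrite lebesgue_measure_itv/= ltry.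
- by rewrite lebesgue_measure_itv/= ltNyr.
- by move=> _; exists 0, 0; rewrite !set_itvE.
- by rewrite lebesgue_measure_itv/=.
- by move=> _; exists 0, 0; rewrite !set_itvE.
- by move=> _; exists 0, 0; rewrite !set_itvE.
- by move=> _; exists 0, 0; rewrite !set_itvE.
Qed.

Lemma stieltjes_oc (G : cumulative R R) (a b : R) : a <= b ->
  lebesgue_stieltjes_measure G `]a, b]%classic = (G b - G a)%:E.
Proof.
move=> ab; rewrite /lebesgue_stieltjes_measure /measure_extension.
by rewrite measurable_mu_extE/=; [rewrite wlength_itv_bnd|exact: is_ocitv].
Qed.


(** Outer regularity encloses [N] in an open set of Lebesgue measure below [d]. Its components are
    disjoint intervals, so finite sums of increments of [G] over them stay below [e], and countable
    additivity bounds the Stieltjes measure of the open set by [e]. *)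
Lemma stieltjes_null (G : cumulative R R) (N : set R) : abs_cont setT G ->
  measurable N -> mu N = 0 -> lebesgue_stieltjes_measure G N = 0.
Proof.
move=> GT mN N0; apply/eqP; rewrite eq_le measure_ge0 andbT.
apply/lee_addgt0Pr => e e0; rewrite add0e.
have [d d0 hd] := abs_cont_sum GT e0.
have Noo : (mu N < +oo)%E by rewrite N0 ltry.
have [U [oU NU UN]] := lebesgue_regularity_outer mN Noo d0.
have mU : measurable U by exact: open_measurable.
have Ud : (mu U < d%:E)%E.
  have : (mu U <= mu (U `\` N) + mu N)%E.
    by rewrite -[in leLHS](setDKU NU) measureU2//; exact: measurableD.
  by rewrite N0 adde0 => /le_lt_trans; apply.
pose I := open_disjoint_itv oU.
have IU i : I i `<=` U.
  by rewrite (open_disjoint_itv_bigcup oU) => x Ix; exists i.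
have mI i : measurable (I i) by apply: open_measurable; exact: open_disjoint_itv_open.
have IE i : exists st : R * R, st.1 <= st.2 /\ I i = `]st.1, st.2[%classic.
  have [||s [t st]] := @open_finite_itv (I i) (open_disjoint_itv_open (oU := oU) (i := i)).
  - exact: open_disjoint_itv_is_interval.
  - rewrite (@le_lt_trans _ _ (mu U))//; last by rewrite (lt_trans Ud)// ltry.
    by apply: (le_measure mu); rewrite ?inE//; exact: mI.
  by exists (s, t).
have [st stP] := choice IE.
have muI i : mu (I i) = ((st i).2 - (st i).1)%:E.
  rewrite (stP i).2 lebesgue_measure_itv/= lte_fin.
  have := (stP i).1; rewrite le_eqVlt => /predU1P[->|->]; last by rewrite EFinB.
  by rewrite ltxx subrr.
apply: (@le_trans _ _ (lebesgue_stieltjes_measure G U)).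
  by apply: (le_measure (lebesgue_stieltjes_measure G)); rewrite ?inE.
rewrite (open_disjoint_itv_bigcup oU) measure_semi_bigcup//; last 2 first.
  exact: open_disjoint_itv_trivIset.
  by apply: bigcup_measurable => i _; exact: mI.
apply: lime_le; first by apply: is_cvg_nneseries => n _ _; exact: measure_ge0.
near=> n; rewrite big_mkord.
apply: (@le_trans _ _ (\sum_(i < n) (G (st i).2 - G (st i).1)%:E)%E).
  (* The Stieltjes measure is explicit on half-open intervals, each of which contains the
     corresponding open component. *)
  apply: lee_sum => i _; rewrite -stieltjes_oc; last exact: (stP i).1.
  rewrite -/(I i) (stP i).2; apply: (le_measure (lebesgue_stieltjes_measure G)); rewrite ?inE//.
  by apply: subset_itvl; rewrite bnd_simp.
rewrite sumEFin lee_fin; apply: le_trans (_ : \sum_(i < n) `|G (st i).2 - G (st i).1| <= _).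
  by apply: ler_sum => i _; exact: ler_norm.
apply/ltW/(hd 'I_n xpredT (fun i => (st i).1) (fun i => (st i).2)) => [i _||].
- by split => //; exact: (stP i).1.
- move=> i j _ _ [x [/= xi xj]]; apply/val_inj.
  apply: (open_disjoint_itv_trivIset (oU := oU)) => //; exists x; split.
    by rewrite -/(I i) (stP i).2.
  by rewrite -/(I j) (stP j).2.
rewrite -lte_fin; apply: le_lt_trans Ud.
rewrite [in leRHS](open_disjoint_itv_bigcup oU) measure_semi_bigcup//; last 2 first.
  exact: open_disjoint_itv_trivIset.
  by apply: bigcup_measurable => i _; exact: mI.
rewrite -sumEFin; apply: le_trans (nneseries_lim_ge n _); last by move=> *; exact: measure_ge0.
rewrite big_mkord; apply: lee_sum => i _.
by rewrite -muI.
Unshelve. all: by end_near. Qed.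

Lemma nondecreasing_density G a b : {homo G : x y / x <= y} -> abs_cont setT G -> 
  exists2 g : R -> R, mu.-integrable setT (EFin \o g) &
    forall x, a <= x <= b -> G x - G a = \int[mu]_(t in `]a, x]) g t.
Proof.
move=> ndG GT.
have cG : right_continuous G by apply: right_continuousW; exact: abs_cont_continuous.
pose Gc : cumulative R R := HB.pack G (isCumulative.Build R _ R G ndG cG).
have GcT : abs_cont setT Gc by [].
pose nu : {measure set (measurableTypeR R) -> \bar R} := lebesgue_stieltjes_measure Gc.
have nuE s t : s <= t -> nu `]s, t]%classic = (G t - G s)%:E by exact: stieltjes_oc.
have mD : measurable (`]a, b]%classic : set (measurableTypeR R)) by [].
have nuD : (nu `]a, b]%classic < +oo)%E.
  have [ab|ba] := leP a b; first by rewrite nuE// ltry.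
  have -> : `]a, b]%classic = set0 :> set R.
    by rewrite set_itv_ge// -leNgt bnd_simp ltW.
  by rewrite /nu measure0.
(* Restriction to []a, b]] makes the Stieltjes measure finite; [stieltjes_null] then gives the
   domination that the Radon-Nikodym theorem asks for. *)
pose nuf : {finite_measure set (measurableTypeR R) -> \bar R} := mfrestr mD nuD.
have dom : nuf `<< mu.
  apply/null_content_dominatesP => A mA A0.
  rewrite /= /mfrestr /mrestr; apply: (subset_measure0 (B := A)) => //.
    exact: measurableI.
  exact: stieltjes_null.
have [f [f0 ffin intf fE]] := radon_nikodym_sigma_finite dom.
have fg : EFin \o (fine \o f) = f by apply/funext => x /=; rewrite fineK.
exists (fine \o f); first by rewrite fg.
move=> x /andP[ax xb]; rewrite /Rintegral.
under eq_integral => t _ do rewrite /= fineK//.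
rewrite -fE// /= /mfrestr /mrestr setIidl ?nuE//.
by apply: subset_itvl; rewrite bnd_simp.
Qed.

End Density.

(** * Total variation and densities of absolutely continuous functions *)

Section TotalVariation.
Context {R : realType}.
Implicit Types (G f g h H : R -> R) (a b : R).
Notation mu := (@lebesgue_measure R).
Notation TV := total_variation.

(** Subdividing every interval of a disjoint family gives another finite disjoint family of the same
    total length, so the [d] of absolute continuity also controls sums of variations. *)
Lemma abs_cont_variation H e : abs_cont setT H -> 0 < e ->
  exists2 d, 0 < d & forall m (s t : 'I_m -> R) (l : 'I_m -> seq R),
    (forall i, itv_partition (s i) (t i) (l i)) ->
    trivIset setT (fun i => `]s i, t i[%classic) ->
    \sum_(i < m) (t i - s i) < d ->
    \sum_(i < m) variation (s i) (t i) H (l i) < e.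
Proof.
move=> HT e0; have [d d0 hd] := abs_cont_sum HT e0; exists d => // m s t l st tr std.
pose F i j := nth (t i) (s i :: l i) j.
have Fmono i j k : (j <= k)%N -> (k < (size (l i)).+1)%N -> F i j <= F i k.
  move=> jk kl; have [p _] := st i.
  by apply: (le_sorted_leq_nth _) => //; rewrite ?inE//; [apply: sub_path p => x y /ltW|exact: leq_ltn_trans kl].
have Fge i j : (j < (size (l i)).+1)%N -> s i <= F i j.
  by move=> jl; exact: itv_partition_nth_ge.
have Fle i j : (j < (size (l i)).+1)%N -> F i j <= t i.
  by move=> jl; exact: itv_partition_nth_le.
(* A piece is indexed by its parent interval and its position in the partition of that parent. *)
pose T := {i : 'I_m & 'I_(size (l i))}.
have -> : \sum_(i < m) variation (s i) (t i) H (l i) =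
    \sum_(p : T) `|H (F (tag p) (tagged p).+1) - H (F (tag p) (tagged p))|.
  rewrite -(sig_big_dep xpredT (fun=> xpredT) (fun i (j : 'I_(size (l i))) => `|H (F i j.+1) - H (F i j)|))//=.
  by apply: eq_bigr => i _; rewrite /variation big_mkord.
apply: hd.
- by move=> [i j] _ /=; split => //; apply: Fmono => //; rewrite ltnS.
- move=> [i j] [i' j'] _ _ [x []]; rewrite /= !in_itv/= => /andP[x1 x2] /andP[x3 x4].
  (* Overlapping pieces lie in overlapping parents, hence in the same one; within one parent the
     order of the partition points separates distinct pieces. *)
  have ii : i = i'.
    apply: tr => //; exists x; split; rewrite /= in_itv/=; apply/andP; split.
    + by apply: le_lt_trans x1; apply: Fge; rewrite ltnS ltnW.
    + by apply: (lt_le_trans x2); apply: Fle; rewrite ltnS.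
    + by apply: le_lt_trans x3; apply: Fge; rewrite ltnS ltnW.
    + by apply: (lt_le_trans x4); apply: Fle; rewrite ltnS.
  move: j' x3 x4; rewrite -ii => j' x3 x4; congr existT; apply/val_inj => /=.
  case: (ltngtP j j') => // jj'; exfalso.
  + have := Fmono i j.+1 j' jj'; rewrite ltnS ltnW// => /(_ isT) h.
    by have := lt_trans x2 (le_lt_trans h x3); rewrite ltxx.
  + have := Fmono i j'.+1 j jj'; rewrite ltnS ltnW// => /(_ isT) h.
    by have := lt_trans x4 (le_lt_trans h x1); rewrite ltxx.
- rewrite [ltLHS](_ : _ = \sum_(i < m) (t i - s i))//.
  rewrite -(sig_big_dep xpredT (fun=> xpredT) (fun i (j : 'I_(size (l i))) => F i j.+1 - F i j))//=.
  apply: eq_bigr => i _; rewrite -(big_mkord xpredT (fun j => F i j.+1 - F i j)).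
  by rewrite telescope_sumr// /F (itv_partition_nth_size _ (st i)).
Qed.

(** On an interval shorter than [d] every variation is at most 1, and finitely many steps of length
    [d / 2] lead from [a] past [b]. *)
Lemma abs_cont_bounded_variation H a b : abs_cont setT H -> a <= b ->
  bounded_variation a b H.
Proof.
move=> HT ab; have [d d0 hd] := abs_cont_variation HT ltr01.
have short x y : x <= y -> y - x < d -> bounded_variation x y H.
  move=> xy yxd; exists 1 => _ [l lxy <-].
  have := hd 1%N (fun=> x) (fun=> y) (fun=> l) (fun=> lxy).
  rewrite !big_ord1 => /(_ _ yxd)/ltW; apply.
  by move=> i j; rewrite !ord1.
pose N := (Num.truncn ((b - a) / (d / 2))).+1.
have ind n : bounded_variation a (a + n%:R * (d / 2)) H.
  elim: n => [|n ih]; first by rewrite mul0r addr0; exact: bounded_variationxx.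
  have le1 : a <= a + n%:R * (d / 2) by rewrite lerDl mulr_ge0//; lra.
  have le2 : a + n%:R * (d / 2) <= a + n.+1%:R * (d / 2).
    by rewrite lerD2l ler_wpM2r ?ler_nat//; lra.
  apply/bounded_variationP; first exact: le_trans le2.
  rewrite (total_variationD _ le1 le2) fin_numD; apply/andP; split.
    exact/bounded_variationP.
  apply/bounded_variationP => //; apply: short => //.
  by rewrite -(natr1 n) mulrDl; lra.
apply: (bounded_variationl ab _ (ind N)).
rewrite -lerBlDl -ler_pdivrMr; last by lra.
by apply/ltW; rewrite /N truncnS_gt.
Qed.

(** The variation function of [H] started at [a]. The maximum freezes it at 0 to the left of [a], so
    that it is monotone on the whole line, as [nondecreasing_density] demands. *)
Let v a H x : R := fine (TV a (Num.max a x) H).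

Let tv_fin H x y : abs_cont setT H -> x <= y -> TV x y H \is a fin_num.
Proof. by move=> HT xy; apply/bounded_variationP => //; exact: abs_cont_bounded_variation. Qed.

Let vB a H x y : abs_cont setT H -> x <= y ->
  v a H y - v a H x = fine (TV (Num.max a x) (Num.max a y) H).
Proof.
move=> HT xy; have xy' : Num.max a x <= Num.max a y by exact: le_max2.
have ax : a <= Num.max a x by rewrite le_max lexx.
rewrite /v (total_variationD _ ax xy') fineD ?tv_fin//.
by rewrite addrAC subrr add0r.
Qed.

Let v_homo a H : abs_cont setT H -> {homo v a H : x y / x <= y}.
Proof.
move=> HT x y xy; rewrite -subr_ge0 vB// fine_ge0// total_variation_ge0//.
exact: le_max2.
Qed.

(** On each interval a partition is chosen whose variation nearly attains the total variation;
    [abs_cont_variation] bounds the sum over these partitions. *)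
Let v_abs_cont a H : abs_cont setT H -> abs_cont setT (v a H).
Proof.
move=> HT e e0; have e20 : 0 < e / 2 by lra.
have [d d0 hd] := abs_cont_variation HT e20; exists d => // m s t st tr std.
pose s' i := Num.max a (s i); pose t' i := Num.max a (t i).
have st' i : s' i <= t' i by apply: le_max2 => //; exact: ltW (st i).1.
(* The [m] errors add up to at most [e / 2]; the successor keeps the divisor nonzero when [m] is
   0. *)
pose eta := e / 2 / m.+1%:R.
have eta0 : 0 < eta by rewrite divr_gt0.
have ex i : exists l, itv_partition (s' i) (t' i) l /\
    fine (TV (s' i) (t' i) H) <= variation (s' i) (t' i) H l + eta.
  have [_ [_ [l lst <-] <-] lt] := ub_ereal_sup_adherent eta0 (tv_fin HT (st' i)).
  exists l; split => //; rewrite -lee_fin fineK ?tv_fin// EFinD -leeBlDr//.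
  exact/ltW.
have [l lP] := choice ex.
have vE i : `|v a H (t i) - v a H (s i)| = fine (TV (s' i) (t' i) H).
  have sti : s i <= t i by exact: ltW (st i).1.
  by rewrite ger0_norm ?subr_ge0 ?v_homo// vB.
under eq_bigr do rewrite vE.
apply: (@le_lt_trans _ _ (\sum_(i < m) (variation (s' i) (t' i) H (l i) + eta))).
  by apply: ler_sum => i _; exact: (lP i).2.
rewrite big_split/= sumr_const card_ord.
have etam : eta *+ m <= e / 2.
  rewrite -mulr_natr /eta -mulrA ler_piMr//; first exact: ltW.
  by rewrite mulrC ler_pdivrMr// mul1r ler_nat.
suff : \sum_(i < m) variation (s' i) (t' i) H (l i) < e / 2 by lra.
apply: hd => [i||]; first exact: (lP i).1.
- move=> i j _ _ [x [/= x1 x2]]; apply: tr => //; exists x; move: x1 x2.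
  by rewrite /= !in_itv/= /s' /t' !gt_max !lt_max => /andP[/andP[ax xs] x1] /andP[/andP[_ xs2] x2]; rewrite xs xs2;
   move: x1 x2; rewrite ltNge (ltW ax)/= => -> ->.
- apply: le_lt_trans std; apply: ler_sum => i _; rewrite /s' /t'.
  have := (st i).1; case: (leP a (t i)); case: (leP a (s i)); lra.
Qed.

(** [Num.max a] is monotone and contracting, and a point strictly inside a truncated interval lies
    strictly inside the original one, so disjointness is kept. *)
Let abs_cont_max a H : abs_cont setT H -> abs_cont setT (H \o Num.max a).
Proof.
move=> HT e e0; have [d d0 hd] := abs_cont_sum HT e0.
exists d => // m s t st tr std.
apply: (hd 'I_m xpredT (Num.max a \o s) (Num.max a \o t)).
- by move=> i _; split => //=; apply: le_max2 => //; exact: ltW (st i).1.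
- move=> i j _ _ [x [/= x1 x2]]; apply: tr => //; exists x; move: x1 x2.
  rewrite /= !in_itv/= !gt_max !lt_max => /andP[/andP[ax xs] x1] /andP[/andP[_ xs2] x2].
  by rewrite xs xs2; move: x1 x2; rewrite ltNge (ltW ax)/= => -> ->.
- apply: le_lt_trans std; apply: ler_sum => i _ /=.
  by have := (st i).1; case: (leP a (t i)); case: (leP a (s i)); lra.
Qed.

(** Jordan decomposition: to the right of [a], [H] is the difference of [v a H] and [q]. Increments
    of [H] are bounded by its variation, so [q] is nondecreasing; both parts are absolutely
    continuous, and their densities are subtracted. *)
Theorem abs_cont_density H a b : abs_cont setT H ->
  exists2 g : R -> R, mu.-integrable setT (EFin \o g) &
    forall x, a <= x <= b -> H x - H a = \int[mu]_(t in `]a, x]) g t.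
Proof.
move=> HT; pose q x := v a H x - H (Num.max a x).
have q_homo : {homo q : x y / x <= y}.
  move=> x y xy; have xy' : Num.max a x <= Num.max a y by exact: le_max2.
  have : H (Num.max a y) - H (Num.max a x) <= v a H y - v a H x.
    rewrite vB//; apply: le_trans (ler_norm _) _.
    by rewrite -lee_fin fineK ?tv_fin//; exact: total_variation_ge.
  by rewrite /q; lra.
have vT : abs_cont setT (v a H) by exact: v_abs_cont.
have qT : abs_cont setT q.
  apply: (abs_cont_dominated (C := 1) vT (abs_cont_max a HT)) => x y _ _.
  rewrite mul1r /q /=.
  rewrite (_ : _ - _ = (v a H y - v a H x) - (H (Num.max a y) - H (Num.max a x))); last by ring.
  exact: ler_normB.
have [g1 ig1 g1E] := nondecreasing_density a b (v_homo a HT) vT.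
have [g2 ig2 g2E] := nondecreasing_density a b q_homo qT.
exists (g1 \- g2) => [|x axb].
  by rewrite (_ : _ \o _ = (EFin \o g1) \- (EFin \o g2))%E//; exact: integrableB.
rewrite RintegralB//; [|exact: integrableS ig1|exact: integrableS ig2].
rewrite -g1E// -g2E// /q maxxx; have /andP[/max_idPr -> _] := axb; ring.
Qed.

End TotalVariation.

(** * Convolution with an integrable kernel *)

Section Reflection.
Context {R : realType}.
Notation mu := (@lebesgue_measure R).

Let measurable_subl (c : R) : measurable_fun setT (fun x : measurableTypeR R => c - x : measurableTypeR R).
Proof. by apply: (@measurable_funB _ (measurableTypeR R) R setT (cst c) id). Qed.

(** Lebesgue measure is determined by its values on half-open intervals, and reflection preserves
    the length of an interval. *)
Let lebesgue_measure_reflect (c : R) (A : set R) : measurable A ->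
  pushforward mu (fun x : measurableTypeR R => c - x : measurableTypeR R) A = mu A.
Proof.
move=> mA; apply/esym/lebesgue_measure_unique => //= _ [[a b]] _ <- /=.
have -> : pushforward mu (fun x : measurableTypeR R => c - x : measurableTypeR R)
    `]a, b]%classic = mu `[c - b, c - a[%classic.
  congr (mu _); apply/seteqP; split => x /=; rewrite !in_itv/=; lra.
rewrite !lebesgue_measure_itv/= !lte_fin ltrD2l ltrN2; case: ifP => // _.
by rewrite -!EFinB; congr EFin; ring.
Qed.

Lemma ge0_integral_reflect (c : R) (f : R -> \bar R) : measurable_fun setT f ->
  (forall x, 0 <= f x)%E ->
  (\int[mu]_x f (c - x)%R = \int[mu]_x f x)%E.
Proof.
move=> mf f0; rewrite -[RHS](@eq_measure_integral _ _ _ _ _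
  (pushforward mu (fun x : measurableTypeR R => c - x : measurableTypeR R))).
  rewrite ge0_integral_pushforward//.
by move=> A mA _; exact: lebesgue_measure_reflect.
Qed.

Lemma integral_reflect (c : R) (f : R -> \bar R) : measurable_fun setT f ->
  (\int[mu]_x f (c - x)%R = \int[mu]_x f x)%E.
Proof.
move=> mf; rewrite integralE [RHS]integralE.
congr (_ - _)%E.
  have := ge0_integral_reflect c (measurable_funepos mf) (fun x => funepos_ge0 f x).
  by move=> <-; apply: eq_integral => x _; rewrite !funeposE.
have := ge0_integral_reflect c (measurable_funeneg mf) (fun x => funeneg_ge0 f x).
by move=> <-; apply: eq_integral => x _; rewrite !funenegE.
Qed.

Lemma integrable_reflect (c : R) (f : R -> \bar R) :
  mu.-integrable setT f -> mu.-integrable setT (fun x => f (c - x)%R).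
Proof.
move=> /integrableP[mf foo]; apply/integrableP; split; first exact: measurableT_comp (measurable_subl c).
rewrite (ge0_integral_reflect c (f := abse \o f))//=.
exact: measurableT_comp mf.
Qed.

(** An integrable function is finite almost everywhere. This turns the extended-real marginals of
    Fubini's theorem into real functions. *)
Lemma integral_fine d (T : measurableType d) (nu : {measure set T -> \bar R})
    (D : set T) (f : T -> \bar R) : measurable D -> nu.-integrable D f ->
  nu.-integrable D (EFin \o (fine \o f)) /\
  (\int[nu]_(x in D) f x = \int[nu]_(x in D) (fine (f x))%:E)%E.
Proof.
move=> mD fi; have /integrableP[mf foo] := fi.
have mff : measurable_fun D (EFin \o (fine \o f)).
  by apply/measurable_EFinP; exact: measurableT_comp mf.
have ae : ae_eq nu D f (EFin \o (fine \o f)).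
  by apply: filterS (integrable_ae mD fi) => x /= h Dx; rewrite fineK// h.
split; last exact: ae_eq_integral.
apply: le_integrable fi => // x _ /=.
by case: (f x) => [r||] //=; rewrite ?normr0 ?leey.
Qed.

End Reflection.

(** * Fubini's theorem for convolutions on the whole line *)

Section Convolution.
Context {R : realType}.
Notation mu := (@lebesgue_measure R).
Implicit Types (k g : R -> R).

Lemma Rintegral_reflect (c : R) g : measurable_fun setT g ->
  \int[mu]_x g (c - x) = \int[mu]_x g x.
Proof.
by move=> mg; rewrite /Rintegral (integral_reflect c (f := EFin \o g))//; exact/measurable_EFinP.
Qed.

(** A translation is the composite of two reflections. *)
Lemma Rintegral_shift (c : R) g : measurable_fun setT g ->
  \int[mu]_x g (x - c) = \int[mu]_x g x.
Proof.
move=> mg; rewrite -[RHS](Rintegral_reflect (- c))//.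
rewrite -[RHS](Rintegral_reflect 0)//.
  by apply: eq_Rintegral => x _; congr g; ring.
by apply: measurableT_comp => //; exact: measurable_funB.
Qed.

Lemma integrable_shift (c : R) g : mu.-integrable setT (EFin \o g) ->
  mu.-integrable setT (EFin \o (fun x => g (x - c))).
Proof.
move=> /(integrable_reflect (- c)) /(integrable_reflect 0).
by apply: eq_integrable => // x _ /=; congr (g _)%:E; ring.
Qed.

(** The convolution integrand in the coordinates [u] and [r = u - s]. With [r] fixed, the factor
    [k r] is constant and the other factor is a translate of [g]. *)
Let convF k g (z : R * R) : \bar R := (k z.2 * g (z.1 - z.2))%:E.

(** Tonelli's theorem with translation invariance: the double integral of the absolute value is the
    product of the two L1 norms. *)
Let integrable_convF k g : mu.-integrable setT (EFin \o k) ->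
  mu.-integrable setT (EFin \o g) ->
  (mu \x mu)%E.-integrable setT (convF k g).
Proof.
move=> ik ig; have mk : measurable_fun setT k by apply/measurable_EFinP; exact: measurable_int ik.
have mg : measurable_fun setT g by apply/measurable_EFinP; exact: measurable_int ig.
apply/integrable21ltyP.
  apply/measurable_EFinP; apply: measurable_funM; first exact: measurableT_comp mk _.
  apply: measurableT_comp mg _; exact: measurable_funB.
have -> : (\int[mu]_x \int[mu]_y `|convF k g (y, x)|)%E =
    (\int[mu]_x (`|k x|%:E * \int[mu]_y `|g y|%:E))%E.
  apply: eq_integral => x _.
  under eq_integral do rewrite /convF /= normrM EFinM.
  rewrite ge0_integralZl//; last first.
    by apply/measurable_EFinP/measurableT_comp => //; apply: measurableT_comp => //; exact: measurable_funB.
  congr (_ * _)%E.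
  have mng : measurable_fun setT (fun y => `|g y|%:E).
    by apply/measurable_EFinP; exact: measurableT_comp.
  rewrite -[RHS](ge0_integral_reflect (- x) mng)//.
  rewrite -[RHS](ge0_integral_reflect 0 (f := fun y => `|g (- x - y)|%:E))//.
    by apply: eq_integral => y _; congr (`|g _|%:E); ring.
  by apply/measurable_EFinP/measurableT_comp => //; apply: measurableT_comp => //; exact: measurable_funB.
rewrite ge0_integralZr//; last 2 first.
  by apply/measurable_EFinP; exact: measurableT_comp.
  by apply: integral_ge0 => y _.
rewrite lte_mul_pinfty//.
- exact: integral_ge0.
- by rewrite ge0_fin_numE ?integral_ge0//; case/integrableP : ik.
- by case/integrableP : ig.
Qed.

(** With [r = x - t], the primitive of [g] at [x - r] is the integral of [g (u - r)] over [u <= x].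
    Exchanging the integrals in [u] and [r] leaves the convolution of [k] and [g], integrated up to
    [x]. *)
Lemma conv_primitive k g x : mu.-integrable setT (EFin \o k) ->
  mu.-integrable setT (EFin \o g) ->
  let psi u := \int[mu]_s (k (u - s) * g s) in
  [/\ mu.-integrable setT (EFin \o psi),
      mu.-integrable setT (EFin \o (fun t => k (x - t) * \int[mu]_(s in `]-oo, t]) g s)) &
      \int[mu]_t (k (x - t) * \int[mu]_(s in `]-oo, t]) g s) =
      \int[mu]_(u in `]-oo, x]) psi u].
Proof.
move=> ik ig psi; have iF := integrable_convF ik ig.
have mk : measurable_fun setT k by apply/measurable_EFinP; exact: measurable_int ik.
have mg : measurable_fun setT g by apply/measurable_EFinP; exact: measurable_int ig.
have psif : psi = fine \o (fun u => \int[mu]_r convF k g (u, r))%E.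
  apply/funext => u; rewrite /psi -(Rintegral_reflect u) /Rintegral.
    by congr fine; apply: eq_integral => r _; rewrite /convF /= opprB addrC subrK.
  by apply: measurable_funM => //; apply: measurableT_comp => //; exact: measurable_funB.
have iP := integrable_fubini_F iF.
have [ipsi _] := integral_fine measurableT iP.
have {}ipsi : mu.-integrable setT (EFin \o psi) by rewrite psif.
(* The cutoff [u <= x] is built into the integrand, so that Fubini's theorem applies on the whole
   plane. *)
pose F1 (z : R * R) : \bar R := (k z.2 * g (z.1 - z.2) * \1_(`]-oo, x]%classic) z.1)%:E.
have iF1 : (mu \x mu)%E.-integrable setT F1.
  apply: le_integrable iF => //.
    apply/measurable_EFinP; apply: measurable_funM.
      apply: measurable_funM; first exact: measurableT_comp mk _.
      apply: measurableT_comp mg _; exact: measurable_funB.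
    by apply: measurableT_comp => //; exact: measurable_indic.
  move=> z _; rewrite /F1 /convF lee_fin normrM indicE.
  by case: (_ \in _); rewrite ?normr1 ?mulr1// normr0 mulr0.
pose Q r := k r * \int[mu]_(s in `]-oo, x - r]) g s.
have inner r : (\int[mu]_u F1 (u, r) = (Q r)%:E)%E.
  pose gr u := g (u - r) * \1_(`]-oo, x]%classic) u.
  have igr : mu.-integrable setT (EFin \o gr).
    apply: le_integrable (integrable_shift r ig) => //.
      apply/measurable_EFinP; apply: measurable_funM => //.
      by apply: measurableT_comp => //; exact: measurable_funB.
    move=> u _; rewrite /= lee_fin normrM indicE.
    by case: (_ \in _); rewrite ?normr1 ?mulr1// normr0 mulr0.
  rewrite (_ : (fun u => F1 (u, r)) = (fun u => (k r)%:E * (EFin \o gr) u)%E); last first.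
    by apply/funext => u; rewrite /F1 /gr /= -EFinM mulrA.
  rewrite integralZl// /Q EFinM; congr (_ * _)%E.
  rewrite -[LHS]fineK ?integrable_fin_num//; congr EFin.
  rewrite -/(Rintegral _ _ _) [RHS]Rintegral_mkcond patch_indic.
  rewrite -[RHS](Rintegral_shift r); last by apply: measurable_funM.
  apply: eq_Rintegral => u _ /=; congr (_ * _); rewrite !indicE.
  by congr ((_ : bool)%:R); rewrite !mem_setE !in_itv/= lerBlDr subrK.
have iQ : mu.-integrable setT (EFin \o Q).
  pose M := \int[mu]_s `|g s|.
  (* The primitive of [g] is bounded by the L1 norm [M] of [g], so [Q] is dominated by a multiple of
     [k]. *)
  have ikM : mu.-integrable setT (EFin \o (fun r => k r * M)).
    rewrite (_ : _ \o _ = (fun r => (EFin \o k) r * M%:E)%E)//; exact: integrableZr.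
  apply: le_integrable ikM => //.
  - rewrite (_ : EFin \o Q = (fun r => \int[mu]_u F1 (u, r))%E).
      exact: measurable_fubini_G iF1.
    by apply/funext => r; rewrite inner.
  - move=> r _; rewrite /= lee_fin !normrM ler_wpM2l// (le_trans (le_normr_Rintegral _ _))//.
      exact: integrableS ig.
    rewrite [leRHS]ger0_norm; last by apply: Rintegral_ge0 => *.
    apply: fine_le.
    + by apply: integrable_fin_num => //; apply: integrableS (integrable_norm ig).
    + by apply: integrable_fin_num => //; exact: (integrable_norm ig).
    + apply: ge0_subset_integral => //; exact: measurable_int (integrable_norm ig).
have QE t : k (x - t) * \int[mu]_(s in `]-oo, t]) g s = Q (x - t).
  by rewrite /Q; congr (_ * Rintegral _ _ _); rewrite opprB addrC subrK.
split => //.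
  by under [X in EFin \o X]eq_fun do rewrite QE; exact: integrable_reflect iQ.
under eq_Rintegral do rewrite QE.
rewrite (Rintegral_reflect x (g := Q)); last by apply/measurable_EFinP; exact: measurable_int iQ.
rewrite /Rintegral; under eq_integral do rewrite -inner.
rewrite -(Fubini iF1) integral_mkcond/=; congr fine.
have -> : (\int[mu]_u \int[mu]_r F1 (u, r) =
    \int[mu]_u ((fun u => \int[mu]_r convF k g (u, r)) \_ `]-oo, x]) u)%E.
  apply: eq_integral => u _; rewrite patchE; case: ifPn => ux.
    by apply: eq_integral => r _; rewrite /convF /F1 /= indicE ux mulr1.
  rewrite (eq_integral (cst 0%E)) ?integral0// => r _.
  by rewrite /F1 /= indicE (negbTE ux) mulr0.
rewrite -!integral_mkcond psif.
have iPx : mu.-integrable `]-oo, x] (fun u => \int[mu]_r convF k g (u, r))%E.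
  exact: integrableS iP.
by have [|_ ->] := integral_fine _ iPx.
Qed.

End Convolution.

(** * Convolution on a bounded interval *)

Section LocalConvolution.
Context {R : realType}.
Notation mu := (@lebesgue_measure R).
Implicit Types (k g h : R -> R) (a b c : R).

Let Rintegral_eq0 (D : set R) g : (forall x, D x -> g x = 0) ->
  \int[mu]_(x in D) g x = 0.
Proof.
move=> g0; rewrite /Rintegral (eq_integral (cst 0%E)) ?integral0// => x.
by rewrite inE => Dx; rewrite g0.
Qed.

Definition convolution a k h x : R := \int[mu]_(t in `]a, x[) (k (x - t) * h t).

Lemma conv_density a b k g c h :
  mu.-integrable `]0, b - a[ (EFin \o k) -> mu.-integrable `]a, b[ (EFin \o g) ->
  (forall x, a < x < b -> h x = c + \int[mu]_(t in `]a, x]) g t) ->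
  let phi u := c * k (u - a) + convolution a k g u in
  [/\ mu.-integrable `]a, b[ (EFin \o phi),
    forall x, a < x < b -> convolution a k h x = \int[mu]_(t in `]a, x]) phi t &
    forall x, a < x < b -> mu.-integrable `]a, x[ (EFin \o (fun t => k (x - t) * h t))].
Proof.
(* Extension by zero localizes the whole-line convolution: [kt (x - t)] vanishes for [t >= x] and
   [gt] vanishes to the left of [a], so primitives may start at minus infinity. *)
move=> ik ig hE phi; pose kt := k \_ `]0, b - a[; pose gt := g \_ `]a, b[.
have ikt : mu.-integrable setT (EFin \o kt).
  by move: ik; rewrite integrable_mkcond// restrict_EFin.
have igt : mu.-integrable setT (EFin \o gt).
  by move: ig; rewrite integrable_mkcond// restrict_EFin.
have mkt : measurable_fun setT kt by apply/measurable_EFinP; exact: measurable_int ikt.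
have ktE r : 0 < r < b - a -> kt r = k r.
  by move=> r0; rewrite /kt patchE mem_set//= in_itv.
have kt0 r : r <= 0 -> kt r = 0.
  by move=> r0; rewrite /kt patchE memNset//= in_itv/= ltNge r0.
have gtE s : a < s < b -> gt s = g s.
  by move=> s0; rewrite /gt patchE mem_set//= in_itv.
have gt0 s : s <= a -> gt s = 0.
  by move=> s0; rewrite /gt patchE memNset//= in_itv/= ltNge s0.
pose psi u := \int[mu]_s (kt (u - s) * gt s).
pose G t := \int[mu]_(s in `]-oo, t]) gt s.
have G0 t : t <= a -> G t = 0.
  move=> ta; apply: Rintegral_eq0 => s.
  by rewrite /= in_itv/= => st; rewrite gt0// (le_trans st).
have GE t : a < t < b -> h t = c + G t.
  move=> /[dup] atb /andP[at_ tb]; rewrite hE// /G /gt -Rintegral_mkcondr; congr (_ + Rintegral _ _ _).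
  by apply/seteqP; split => s /=; rewrite !in_itv/=; lra.
have psi0 u : u <= a -> psi u = 0.
  move=> ua; apply: Rintegral_eq0 => s _.
  have [sa|as_] := leP s a; first by rewrite gt0// mulr0.
  by rewrite kt0 ?mul0r//; lra.
have psiE u : a < u < b -> psi u = convolution a k g u.
  move=> /andP[au ub]; rewrite /psi /convolution [RHS]Rintegral_mkcond.
  apply: eq_Rintegral => s _; rewrite patchE; case: ifPn.
    by rewrite inE/= in_itv/= => asu; rewrite ktE ?gtE//; lra.
  rewrite notin_setE/= in_itv/= => /negP; rewrite negb_and -!leNgt => /orP[sa|us].
    by rewrite gt0// mulr0.
  by rewrite kt0 ?mul0r//; lra.
pose phit u := c * kt (u - a) + psi u.
have phitE u : a < u < b -> phit u = phi u.
  by move=> aub; rewrite /phit /phi psiE// ktE//; lra.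
have phit0 u : u <= a -> phit u = 0.
  by move=> ua; rewrite /phit psi0// kt0 ?mulr0 ?addr0//; lra.
have ika : mu.-integrable setT (EFin \o (fun u => c * kt (u - a))).
  rewrite (_ : _ \o _ = (fun u => c%:E * (EFin \o (fun u => kt (u - a)%R)) u)%E)//.
  by apply: integrableZl => //; exact: integrable_shift.
have iphit : mu.-integrable setT (EFin \o phit).
  have [ipsi _ _] := conv_primitive a ikt igt.
  by rewrite (_ : _ \o _ = (EFin \o (fun u => c * kt (u - a))%R) \+ (EFin \o psi))%E//; exact: integrableD.
(* [h] splits into [c] and [G]. [G] vanishes to the left of [a] by itself; the constant needs the
   indicator. *)
have key x t : a < x < b -> ((fun t => k (x - t) * h t) \_ `]a, x[) t =
    c * (kt (x - t) * \1_(`]a, +oo[%classic) t) + kt (x - t) * G t.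
  move=> /andP[ax xb]; have -> : \1_(`]a, +oo[%classic) t = (a < t)%R%:R :> R by rewrite indicE mem_setE in_itv/= andbT.
  rewrite patchE; case: ifPn.
    rewrite inE/= in_itv/= => /andP[at_ tx]; rewrite at_ mulr1 ktE; last by lra.
    by rewrite GE; [ring|lra].
  rewrite notin_setE/= in_itv/= => /negP; rewrite negb_and -!leNgt => /orP[ta|xt].
    by rewrite G0// ltNge ta/= !mulr0 addr0.
  by rewrite kt0 ?mul0r ?mulr0 ?addr0//; lra.
have i1 x : mu.-integrable setT (EFin \o (fun t => kt (x - t) * \1_(`]a, +oo[%classic) t)).
  apply: le_integrable (integrable_reflect x ikt) => //.
    apply/measurable_EFinP; apply: measurable_funM => //.
    by apply: measurableT_comp => //; exact: measurable_funB.
  move=> u _; rewrite /= lee_fin normrM indicE.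
  by case: (_ \in _); rewrite ?normr1 ?mulr1// normr0 mulr0.
have i1c x : mu.-integrable setT (EFin \o (fun t => c * (kt (x - t) * \1_(`]a, +oo[%classic) t))).
  rewrite (_ : _ \o _ = (fun u => c%:E * (EFin \o (fun t => kt (x - t) * \1_(`]a, +oo[%classic) t)%R) u)%E)//.
  exact: integrableZl.
split.
- apply: eq_integrable (integrableS _ _ _ iphit) => //.
  by move=> u; rewrite inE/= in_itv/= => aub; rewrite phitE.
- move=> x /[dup] axb /andP[ax xb].
  rewrite /convolution Rintegral_mkcond; under eq_Rintegral do rewrite key//.
  have [ipsi ikG kGE] := conv_primitive x ikt igt.
  rewrite RintegralD// kGE RintegralZl//.
  (* The reflection of [t] into [x + a - t] exchanges [t > a] with [u < x] and turns [kt (x - t)]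
     into [kt (u - a)]. *)
  rewrite -(Rintegral_reflect (x + a)); last first.
    by apply/measurable_EFinP; exact: measurable_int (i1 x).
  have -> : \int[mu]_u (kt (x - (x + a - u)) * \1_(`]a, +oo[%classic) (x + a - u)) =
      \int[mu]_(u in `]-oo, x]) kt (u - a).
    rewrite -Rintegral_itv_bndo_bndc; last by apply: integrableS (integrable_shift a ikt).
    rewrite [RHS]Rintegral_mkcond patch_indic; apply: eq_Rintegral => u _ /=.
    congr (kt _ * _); first by ring.
    by rewrite !indicE; congr ((_ : bool)%:R); rewrite !mem_setE !in_itv/=; apply/idP/idP; lra.
  rewrite -RintegralZl//; last by apply: integrableS (integrable_shift a ikt).
  rewrite -RintegralD; [|exact: measurable_itv|exact: integrableS ika|exact: integrableS ipsi].
  rewrite Rintegral_mkcond [RHS]Rintegral_mkcond; apply: eq_Rintegral => u _.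
  rewrite !patchE; case: ifPn; rewrite ?inE ?notin_setE/= in_itv/= => ux.
    case: ifPn; rewrite ?inE ?notin_setE/= in_itv/= => aux.
      by rewrite -phitE//; lra.
    by rewrite -/(phit u) phit0//; lra.
  by rewrite memNset//= in_itv/=; lra.
- move=> x axb; apply/integrable_mkcond => //; rewrite restrict_EFin.
  have [ipsi ikG kGE] := conv_primitive x ikt igt.
  rewrite (_ : _ \_ _ = fun t => c * (kt (x - t) * \1_(`]a, +oo[%classic) t) + kt (x - t) * G t); last first.
    by apply/funext => t; exact: key.
  by rewrite (_ : _ \o _ = (EFin \o (fun t => c * (kt (x - t) * \1_(`]a, +oo[%classic) t))%R)
    \+ (EFin \o (fun t => kt (x - t) * G t)%R))%E//; exact: integrableD.
Qed.

End LocalConvolution.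

(** * Iterated derivatives on an open interval *)

Section IteratedDerivatives.
Context {R : realType}.
Variables (a b : R).
Notation mu := (@lebesgue_measure R).
Implicit Types (P : (R -> R) -> Prop) (f g h : R -> R) (c : R).

(** [P] is the condition on the last derivative: absolute continuity, almost everywhere
    differentiability, or nothing. Derivatives are witnessed by [is_derive], so the default values
    of [derive1] cannot intervene. *)
Fixpoint nder P n f : Prop :=
  if n is m.+1 then
    exists2 g, (forall x, a < x < b -> is_derive x 1 f (g x)) & nder P m g
  else P f.

Definition local_prop P := forall f g,
  (forall x, a < x < b -> f x = g x) -> P f -> P g.

Lemma near_itvoo x : a < x < b -> \forall y \near x, a < y < b.
Proof.
move=> axb; have xab : x \in `]a, b[%R by rewrite in_itv.
by apply: filterS (near_in_itvoo xab) => y; rewrite in_itv.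
Qed.

Lemma is_derive_local x f g df : a < x < b -> (forall x, a < x < b -> f x = g x) ->
  is_derive x 1 f df -> is_derive x 1 g df.
Proof.
move=> axb fg; apply: near_eq_is_derive; near=> y; apply: fg.
by near: y; exact: near_itvoo.
Unshelve. all: by end_near. Qed.

Lemma nder_local P n : local_prop P -> local_prop (nder P n).
Proof.
case: n => //= n _ f g fg [f' ff' nf']; exists f' => // x axb.
exact: is_derive_local axb fg (ff' x axb).
Qed.

Lemma nderD P n f g : (forall f g, P f -> P g -> P (fun x => f x + g x)) ->
  nder P n f -> nder P n g -> nder P n (fun x => f x + g x).
Proof.
move=> PD; elim: n f g => [f g|n ih f g [f' ff' nf'] [g' gg' ng']]; first exact: PD.
exists (fun x => f' x + g' x) => [x axb|]; last exact: ih.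
by apply: is_deriveD; [exact: ff'|exact: gg'].
Qed.

Lemma nderZ P n c f : (forall f, P f -> P (fun x => c * f x)) ->
  nder P n f -> nder P n (fun x => c * f x).
Proof.
move=> PZ; elim: n f => [f|n ih f [f' ff' nf']]; first exact: PZ.
exists (fun x => c * f' x) => [x axb|]; last exact: ih.
by have ? := ff' _ axb; apply: is_deriveZ.
Qed.

Lemma is_derive1E (x df : R) f : is_derive x 1 f df -> derive1 f x = df.
Proof. by move=> fdf; rewrite derive1E; exact: derive_val. Qed.

(** Derivatives are unique on []a, b[], so the witnesses may be replaced by [derive1]; locality of
    [P] absorbs differences outside. *)
Lemma nder_iter P n f : local_prop P -> nder P n f ->
  P (iter n (@derive1 R R) f) /\
  forall k x, (k < n)%N -> a < x < b -> derivable (iter k (@derive1 R R) f) x 1.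
Proof.
move=> lP; elim: n f => [f Pf|n ih f [f' ff' nf']]; first by split.
have nf : nder P n (derive1 f).
  apply: nder_local nf' => // x axb; exact/esym/is_derive1E/ff'.
have [Pn dn] := ih _ nf; split; first by rewrite iterSr.
move=> [|k] x kn axb; first exact: (ff' _ axb).(ex_derive).
by rewrite iterSr; exact: dn.
Qed.

(** The interval is a neighbourhood of each of its points, so the restricted limit of the difference
    quotient is the full one. *)
Lemma has_deriv_is_derive f g x : a < x < b -> has_deriv_on `]a, b[ f g ->
  is_derive x 1 f (g x).
Proof.
move=> axb fg; have xA : `]a, b[%classic x by rewrite /= in_itv/=.
have fgx := fg _ xA.
have cv : (fun r => r^-1 *: (f (r *: 1 + x) - f x)) @ 0^' --> g x.
  apply/cvgrPdist_le => e e0.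
  have [d d0 hd] : exists2 d, 0 < d & forall y, ball x d y -> y != x ->
      `]a, b[%classic y -> `|g x - (f y - f x) / (y - x)| <= e.
    have /cvgrPdist_le/(_ _ e0) := fgx.
    by rewrite /within/= /dnbhs/within/= => /nbhs_ballP[d /= d0 hd]; exists d.
  have /nbhs_ballP[d2 /= d20 hd2] := near_itvoo axb.
  near=> r; have r0 : r != 0 by near: r; exact: nbhs_dnbhs_neq.
  have hsmall : `|r| < Num.min d d2.
    by near: r; apply: dnbhs0_lt; rewrite lt_min d0.
  move: hsmall; rewrite lt_min => /andP[h1 h2].
  have xrB d' : `|r| < d' -> ball x d' (r + x).
    by rewrite /ball/= opprD addrCA subrr addr0 normrN.
  have := hd (r + x) (xrB _ h1); rewrite -subr_eq0 addrK => /(_ r0).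
  rewrite -[_ *: (f _ - f x)]/(_ * _) [_ * (f _ - f x)]mulrC -[r *: 1]/(r * 1) mulr1; apply.
  by rewrite /= in_itv/=; exact: hd2 (xrB _ h2).
split; first by apply/cvg_ex; exists (g x).
by apply: cvg_lim.
Unshelve. all: by end_near. Qed.

Lemma derivs_on_nder P n f d : local_prop P -> derivs_on `]a, b[ n f d ->
  P (d n) -> nder P n f.
Proof.
move=> lP; elim: n f d => [f d [df _]|n ih f d [df dd] Pd].
  by apply: (lP (d 0%N)) => x axb; apply: df; rewrite /= in_itv/=.
exists (d 1%N) => [x axb|].
  apply: (is_derive_local axb _ (has_deriv_is_derive axb (dd 0%N isT))) => y ayb.
  by apply: df; rewrite /= in_itv/=.
by apply: (ih _ (fun k => d k.+1)) => //; split => // k kn; exact: dd.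
Qed.

End IteratedDerivatives.

(** * Regularity of products, primitives and convolutions *)

Section Regularity.
Context {R : realType}.
Variables (a b : R).
Notation mu := (@lebesgue_measure R).
Notation nder := (nder a b).
Implicit Types (P : (R -> R) -> Prop) (f g h k : R -> R) (c : R).

Lemma nderS P n f :
  (forall f g, (forall x, a < x < b -> is_derive x 1 f (g x)) -> P g -> P f) ->
  nder P n.+1 f -> nder P n f.
Proof.
move=> PS; elim: n f => [f [g fg Pg]|n ih f [g fg ng]]; first exact: PS Pg.
by exists g => //; exact: ih.
Qed.

(** The derivative [f g' + g f'] pairs factors of different order; [nderS] first lowers the
    undifferentiated factors to order [n]. *)
Lemma nderM P n f g :
  (forall f g, (forall x, a < x < b -> is_derive x 1 f (g x)) -> P g -> P f) ->
  (forall f g, P f -> P g -> P (fun x => f x + g x)) ->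
  (forall f g, P f -> P g -> P (fun x => f x * g x)) ->
  nder P n f -> nder P n g -> nder P n (fun x => f x * g x).
Proof.
move=> PS PD PM; elim: n f g => [f g|n ih f g]; first exact: PM.
move=> /[dup] /(nderS PS) nf [f' ff' nf'] /[dup] /(nderS PS) ng [g' gg' ng'].
exists (fun x => f x * g' x + g x * f' x) => [x axb|].
  have ? := ff' _ axb; have ? := gg' _ axb; exact: is_deriveM.
by apply: nderD => //; exact: ih.
Qed.

Definition ACoo f := abs_cont `]a, b[ f.

Lemma ACoo_local : local_prop a b ACoo.
Proof.
move=> f g fg fA e e0; have [d d0 hd] := fA e e0; exists d => // m s t st tr std.
rewrite (le_lt_trans _ (hd m s t st tr std))//; apply: ler_sum => i _.
have [sti stA] := st i; rewrite !fg//; [apply: stA|apply: stA].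
- by rewrite /= in_itv/= lexx ltW.
- by rewrite /= in_itv/= lexx ltW.
Qed.

(** The extension to the line is continuous, so its absolute value attains a maximum on the compact
    [[a, b]]. *)
Lemma ACoo_bounded f : a < b -> ACoo f -> exists M, forall x, a < x < b -> `|f x| <= M.
Proof.
move=> ab fA; have [H HT fH] := abs_cont_extend ab fA.
have cH : {within `[a, b], continuous H}.
  by apply: continuous_subspaceT; exact: abs_cont_continuous.
have cN : {within `[a, b], continuous (fun x => `|H x|)}.
  by apply: continuous_subspaceT => x; apply: cvg_norm; exact: abs_cont_continuous.
have [c _ cmax] := EVT_max (ltW ab) cN.
exists `|H c| => x axb; rewrite fH ?in_itv//=; apply: cmax.
by rewrite in_itv/=; lra.
Qed.

Lemma ACoo_continuous f x : ACoo f -> a < x < b -> {for x, continuous f}.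
Proof.
move=> fA axb; have ab : a < b by lra.
have [H HT fH] := abs_cont_extend ab fA.
have nH : \forall y \near x, H y = f y.
  by apply: filterS (near_itvoo axb) => y ayb; rewrite fH// in_itv.
rewrite /prop_for /continuous_at fH ?in_itv//.
have : H y @[y --> x] --> H x by exact: abs_cont_continuous.
by apply: cvg_trans; exact: near_eq_cvg.
Qed.

Lemma ACooD f g : ACoo f -> ACoo g -> ACoo (fun x => f x + g x).
Proof.
move=> fA gA; apply: (abs_cont_dominated (C := 1) fA gA) => x y _ _.
rewrite mul1r (_ : _ - _ = (f y - f x) + (g y - g x)); last by ring.
exact: ler_normD.
Qed.

Lemma ACooM f g : a < b -> ACoo f -> ACoo g -> ACoo (fun x => f x * g x).
Proof.
move=> ab fA gA; have [M fM] := ACoo_bounded ab fA; have [N gN] := ACoo_bounded ab gA.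
apply: (abs_cont_dominated (C := `|M| + `|N|) fA gA) => x y xA yA.
have {}xA : a < x < b by move: xA; rewrite /= in_itv.
have {}yA : a < y < b by move: yA; rewrite /= in_itv.
rewrite (_ : _ - _ = f y * (g y - g x) + g x * (f y - f x)); last by ring.
rewrite (le_trans (ler_normD _ _))// !normrM.
have h1 : `|f y| * `|g y - g x| <= `|M| * `|g y - g x|.
  by rewrite ler_wpM2r// (le_trans (fM _ yA))// ler_norm.
have h2 : `|g x| * `|f y - f x| <= `|N| * `|f y - f x|.
  by rewrite ler_wpM2r// (le_trans (gN _ xA))// ler_norm.
have h3 : 0 <= `|M| * `|f y - f x| by rewrite mulr_ge0.
have h4 : 0 <= `|N| * `|g y - g x| by rewrite mulr_ge0.
lra.
Qed.

Lemma is_derive_continuous (x df : R) f : is_derive x 1 f df -> {for x, continuous f}.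
Proof.
by move=> fdf; apply/differentiable_continuous/derivable1_diffP; exact: ex_derive.
Qed.

Lemma is_derive_MVT f g (x y : R) : (forall x, a < x < b -> is_derive x 1 f (g x)) ->
  a < x -> x < y -> y < b -> exists2 z, a < z < b & f y - f x = g z * (y - x).
Proof.
move=> fg ax xy yb.
have fxy z : z \in `]x, y[%R -> is_derive z 1 f (g z).
  by rewrite in_itv/= => xzy; apply: fg; lra.
have cf : {within `[x, y], continuous f}.
  apply: continuous_in_subspaceT => z; rewrite inE/= in_itv/= => xzy.
  by apply: (is_derive_continuous (df := g z)); apply: fg; lra.
have [z] := MVT xy fxy cf; rewrite in_itv/= => xzy fE.
by exists z => //; lra.
Qed.

(** [g] is bounded, so the mean value theorem makes [f] Lipschitz; the increments of [f] are then
    compared with those of the identity. *)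
Lemma ACoo_primitive f g : a < b ->
  (forall x, a < x < b -> is_derive x 1 f (g x)) -> ACoo g -> ACoo f.
Proof.
move=> ab fg gA; have [M gM] := ACoo_bounded ab gA.
have idA : ACoo id by move=> e e0; exists e => // m s t st tr std; rewrite (le_lt_trans _ std)//;
  apply: ler_sum => i _ /=; rewrite ger0_norm ?subr_ge0// ltW//; exact: (st i).1.
have lip x y : a < x -> x < y -> y < b -> `|f y - f x| <= M * `|y - x|.
  move=> ax xy yb; have [z azb ->] := is_derive_MVT fg ax xy yb.
  by rewrite normrM ler_wpM2r// gM.
apply: (abs_cont_dominated (C := `|M|) idA idA) => x y /=; rewrite !in_itv/= => xA yA.
have h0 : 0 <= `|M| * `|y - x| by rewrite mulr_ge0.
have h1 : M * `|y - x| <= `|M| * `|y - x| by rewrite ler_wpM2r// ler_norm.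
have [xy|yx|->] := ltgtP x y; last by rewrite !subrr normr0 addr0 mulr0.
- by have := lip x y; lra.
- rewrite distrC; have := lip y x; rewrite (distrC y x) in h0 h1 *; lra.
Qed.

Definition ae_derivable f := {ae mu, forall x : R, a < x < b -> derivable f x 1}.

Lemma ae_derivable_local : local_prop a b ae_derivable.
Proof.
move=> f g fg; apply: (@filterS _ _ (ae_filter_ringOfSetsType mu)) => x fx axb.
apply: (near_eq_derivable _ (fx axb)).
by apply: filterS (near_itvoo axb) => y; exact: fg.
Qed.

Lemma ae_derivableD f g : ae_derivable f -> ae_derivable g -> ae_derivable (fun x => f x + g x).
Proof.
by apply: (@filterS2 _ _ (ae_filter_ringOfSetsType mu)) => x fx gx axb; apply: derivableD; [exact: fx|exact: gx].
Qed.

Lemma ae_derivableZ c f : ae_derivable f -> ae_derivable (fun x => c * f x).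
Proof. by apply: (@filterS _ _ (ae_filter_ringOfSetsType mu)) => x fx axb; apply: derivableZ; exact: fx. Qed.


(** The three conclusions are Lebesgue's differentiation theorem, continuity of the integral in its
    upper limit, and the fundamental theorem of calculus at a point of continuity. *)
Lemma primitive_regular f g : a < b -> mu.-integrable `]a, b[ (EFin \o g) ->
  (forall x, a < x < b -> f x = \int[mu]_(t in `]a, x]) g t) ->
  [/\ ae_derivable f, forall x, a < x < b -> {for x, continuous f} &
    forall x, a < x < b -> {for x, continuous g} -> is_derive x 1 f (g x)].
Proof.
move=> ab ig fE; pose gt := g \_ `]a, b[.
have igt : mu.-integrable setT (EFin \o gt).
  by move: ig; rewrite integrable_mkcond// restrict_EFin.
pose F x := \int[mu]_(t in `]a, x]) gt t.
have FE x : a < x < b -> F x = f x.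
  move=> axb; rewrite fE//; apply: eq_Rintegral => t; rewrite inE/= in_itv/= => atx.
  by rewrite /gt patchE mem_set//= in_itv/=; lra.
have igtS (A : set R) : measurable A -> mu.-integrable A (EFin \o gt).
  by move=> mA; apply: integrableS igt.
split.
- apply: (ae_derivable_local FE).
  have := FTC1 (a := BRight a) (f := gt) (fun y => igtS _ (measurable_itv _)) (open_integrable_locally openT igt).
  apply: (@filterS _ _ (ae_filter_ringOfSetsType mu)) => x /= h /andP[ax xb].
  by have [] := h ax.
- move=> x axb.
  have := parameterized_integral_continuous (ltW ab) (igtS _ (measurable_itv `[a, b])).
  move=> /(continuous_within_itvP _ ab)[/(_ x) + _ _]; rewrite in_itv/= => /(_ axb).
  have nE : \forall y \near x, parameterized_integral mu a y gt = f y.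
    apply: filterS (near_itvoo axb) => y ayb.
    by rewrite -FE// /F Rintegral_itv_obnd_cbnd//; exact: igtS.
  rewrite /prop_for /continuous_at (nbhs_singleton nE).
  by apply: cvg_trans; exact: near_eq_cvg.
- move=> x axb cg; have [ax xb] := andP axb.
  have nE : \forall y \near x, g y = gt y.
    by apply: filterS (near_itvoo axb) => y ayb; rewrite /gt patchE mem_set//= in_itv.
  have cgt : {for x, continuous gt}.
    have : g y @[y --> x] --> g x by [].
    rewrite /prop_for /continuous_at -(nbhs_singleton nE).
    by apply: cvg_trans; apply: near_eq_cvg; exact: filterS nE.
  have [|dF FD] := continuous_FTC1 xb (igtS _ (measurable_itv (Interval (BRight a) (BRight b)))) _ cgt.
    exact: ax.
  apply: (is_derive_local axb FE); split => //.
  by rewrite -derive1E FD (nbhs_singleton nE).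
Qed.

(** Induction on [n], the derivative of the convolution being [c k(x - a)] plus the convolution of
    [k] with [h']. Continuity is carried along because the next step differentiates an integral of
    this expression; integrability later allows complex integrals to be split. *)
Lemma conv_regular k n h : a < b -> mu.-integrable `]0, b - a[ (EFin \o k) ->
  (forall m, nder (fun=> True) m (fun x => k (x - a))) ->
  nder ACoo n h ->
  [/\ nder ae_derivable n (convolution a k h),
    forall x, a < x < b -> {for x, continuous (convolution a k h)} &
    forall x, a < x < b -> mu.-integrable `]a, x[ (EFin \o (fun t => k (x - t) * h t))].
Proof.
move=> ab ik kS; elim: n h => [h hA|n ih h [h' hh' nh']].
  have [H HT hH] := abs_cont_extend ab hA.
  have [g ig gE] := abs_cont_density a b HT.
  have hE x : a < x < b -> h x = H a + \int[mu]_(t in `]a, x]) g t.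
    by move=> axb; rewrite hH ?in_itv// -gE; [ring|lra].
  have igI : mu.-integrable `]a, b[ (EFin \o g) by apply: integrableS ig.
  have [iphi kE ikh] := conv_density ik igI hE.
  by have [? ? _] := primitive_regular ab iphi kE.
have h'A : ACoo h' by elim: (n) (h') nh' => [//|m IH f [f' ff' nf']]; exact: ACoo_primitive ff' (IH _ nf').
have [M h'M] := ACoo_bounded ab h'A.
have [ndk ck ikh'] := ih _ nh'.
have hA : ACoo h by exact: ACoo_primitive hh' h'A.
have ih' : mu.-integrable `]a, b[ (EFin \o h').
  have [H HT hH] := abs_cont_extend ab h'A.
  have iH : mu.-integrable `[a, b] (EFin \o H).
    apply: continuous_compact_integrable; first exact: segment_compact.
    by apply: continuous_subspaceT; exact: abs_cont_continuous.
  apply: eq_integrable (integrableS _ _ _ iH) => //.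
    by move=> x; rewrite inE/= => xab; rewrite hH.
  exact: subset_itv_oo_cc.
pose F x := \int[mu]_(t in `]a, x]) h' t.
have [_ _ FD] := primitive_regular ab ih' (fun x _ => erefl (F x)).
(* [h - F] has zero derivative. The hypotheses constrain [h] only inside the open interval, so the
   constant is read off at the midpoint. *)
have [c hE] : exists c, forall x, a < x < b -> h x = c + F x.
  pose m := (a + b) / 2; have amb : a < m < b by rewrite /m; lra.
  have D0 x : a < x < b -> is_derive x 1 (fun x => h x - F x) 0.
    move=> axb; have ? := hh' _ axb.
    have ? : is_derive x 1 F (h' x) by apply: FD => //; exact: ACoo_continuous h'A axb.
    by rewrite -(subrr (h' x)); exact: is_deriveB.
  exists (h m - F m) => x axb; apply/eqP; rewrite -subr_eq; apply/eqP.
  have [xm|mx|->//] := ltgtP x m.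
  + have [|||z _] := is_derive_MVT (x := x) (y := m) D0; [lra|lra|lra|].
    by rewrite mul0r; lra.
  + have [|||z _] := is_derive_MVT (x := m) (y := x) D0; [lra|lra|lra|].
    by rewrite mul0r; lra.
have [iphi kE ikh] := conv_density ik ih' hE.
have [_ _ cD] := primitive_regular ab iphi kE.
have ckx x : a < x < b -> {for x, continuous (fun u => c * k (u - a) + convolution a k h' u)}.
  move=> axb; have [k' kk' _] := kS 1%N.
  have c1 := is_derive_continuous (kk' _ axb).
  apply: cvgD; last exact: ck.
  by apply: cvgM; [exact: cvg_cst|exact: c1].
split => //.
- exists (fun u => c * k (u - a) + convolution a k h' u) => [x axb|]; first by apply: cD => //; exact: ckx.
  apply: (nderD (@ae_derivableD) _ ndk); apply: (nderZ (@ae_derivableZ c)).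
  (* One derivative beyond order [n] gives differentiability everywhere, hence almost everywhere, of
     the [n]-th derivative of the shifted kernel. *)
  elim: (n) (fun x => k (x - a)) (kS n.+1) => [f [f' ff' _]|m IH f [f' ff' nf']].
    by apply: aeW => x axb; case: (ff' _ axb).
  by exists f' => //; exact: IH.
- move=> x axb; exact: is_derive_continuous (cD _ axb (ckx _ axb)).
Qed.

End Regularity.

(** * The power kernel *)

Section PowerKernel.
Context {R : realType}.
Notation mu := (@lebesgue_measure R).
Implicit Types (s tau r : R).

(** With [powsin], the real and imaginary parts of the complex power of [r] with exponent
    [s + i tau]. *)
Definition powcos s tau r : R := r `^ s * cos (tau * ln r).
Definition powsin s tau r : R := r `^ s * sin (tau * ln r).

Lemma is_derive_powR_gt0 s r : 0 < r -> is_derive r 1 (@powR R ^~ s) (s * r `^ (s - 1)).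
Proof.
move=> r0; apply: (@near_eq_is_derive _ _ _ (fun t => expR (s * ln t))).
  near=> t; rewrite /powR gt_eqF//; near: t; exact: lt_nbhsr.
have ? : is_derive r 1 (@ln R) r^-1 by exact: is_derive1_ln.
have powRE t : r `^ t = expR (t * ln r) by rewrite /powR gt_eqF.
apply: is_derive_eq; rewrite !powRE mulrBl mul1r expRB lnK ?posrE//.
rewrite /GRing.scale/=; field; exact: lt0r_neq0.
Unshelve. all: by end_near. Qed.

Lemma is_derive_powcos s tau r : 0 < r ->
  is_derive r 1 (powcos s tau) (s * powcos (s - 1) tau r - tau * powsin (s - 1) tau r).
Proof.
move=> r0; have ? := is_derive_powR_gt0 s r0.
have ? : is_derive r 1 (@ln R) r^-1 by exact: is_derive1_ln.
rewrite /powcos; apply: is_derive_eq.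
have rE : r `^ s = r `^ (s - 1) * r.
  rewrite -[X in _ * X](powRr1 (ltW r0)) -powRD ?subrK//.
  by rewrite (gt_eqF r0) implybT.
rewrite /powcos /powsin rE /GRing.scale/=; field; exact: lt0r_neq0.
Qed.

Lemma is_derive_powsin s tau r : 0 < r ->
  is_derive r 1 (powsin s tau) (s * powsin (s - 1) tau r + tau * powcos (s - 1) tau r).
Proof.
move=> r0; have ? := is_derive_powR_gt0 s r0.
have ? : is_derive r 1 (@ln R) r^-1 by exact: is_derive1_ln.
rewrite /powsin; apply: is_derive_eq.
have rE : r `^ s = r `^ (s - 1) * r.
  rewrite -[X in _ * X](powRr1 (ltW r0)) -powRD ?subrK//.
  by rewrite (gt_eqF r0) implybT.
rewrite /powcos /powsin rE /GRing.scale/=; field; exact: lt0r_neq0.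
Qed.

(** Differentiation lowers [s] by 1 and mixes the two functions linearly, so both are treated in one
    induction with [s] arbitrary. *)
Lemma nder_powcos_powsin (a b s tau : R) n :
  nder a b (fun=> True) n (fun x => powcos s tau (x - a)) /\
  nder a b (fun=> True) n (fun x => powsin s tau (x - a)).
Proof.
elim: n s => [//|n ih s]; have [ihc ihs] := ih (s - 1).
have dsub (x : R) : is_derive x 1 (fun x => x - a) 1.
  by apply: is_derive_eq; rewrite subr0.
split.
  exists (fun x => s * powcos (s - 1) tau (x - a) + - tau * powsin (s - 1) tau (x - a)).
    move=> x axb; have xa : 0 < x - a by lra.
    have := @is_derive1_comp R (powcos s tau) (fun x => x - a) x _ _ (is_derive_powcos s tau xa) (dsub x).
    by move=> /is_derive_eq; apply; ring.
  by apply: nderD => //; apply: nderZ.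
exists (fun x => s * powsin (s - 1) tau (x - a) + tau * powcos (s - 1) tau (x - a)).
  move=> x axb; have xa : 0 < x - a by lra.
  have := @is_derive1_comp R (powsin s tau) (fun x => x - a) x _ _ (is_derive_powsin s tau xa) (dsub x).
  by move=> /is_derive_eq; apply; ring.
by apply: nderD => //; apply: nderZ.
Qed.

(** The intervals [[L / (n + 1), L]] exhaust []0, L[]. On each of them the antiderivative [G] bounds
    the integral by [G L], and monotone convergence carries the bound to the union. *)
Lemma integrable_powR s (L : R) : -1 < s -> 0 < L ->
  mu.-integrable `]0, L[ (EFin \o (@powR R ^~ s)).
Proof.
move=> s1 L0.
pose F (n : nat) : set (measurableTypeR R) := `[n.+1%:R^-1 * L, L]%classic.
pose G r := (s + 1)^-1 * r `^ (s + 1).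
have s10 : 0 < s + 1 by lra.
have dG r : 0 < r -> is_derive r 1 G (r `^ s).
  move=> r0; have ? := is_derive_powR_gt0 (s + 1) r0.
  apply: is_derive_eq; rewrite addrK -[_ *: _]/(_ * _) mulrA mulVf ?mul1r//.
  exact: lt0r_neq0.
have F0 n r : F n r -> 0 < r.
  rewrite /F/= in_itv/= => /andP[+ _]; apply: lt_le_trans.
  by rewrite mulr_gt0// invr_gt0.
have FU : `]0, L[%classic `<=` \bigcup_n F n.
  move=> r /=; rewrite in_itv/= => /andP[r0 rL].
  have rL0 : 0 <= L / r by rewrite divr_ge0// ltW.
  exists (Num.truncn (L / r)) => //; rewrite /F/= in_itv/= (ltW rL) andbT.
  by rewrite mulrC ler_pdivrMr// -ler_pdivrMl// mulrC ltW// truncnS_gt.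
have iF n : (\int[mu]_(r in F n) (r `^ s)%:E <= (G L)%:E)%E.
  (* For [n = 0] the interval is the single point [L]. *)
  have [lt1|] := ltP (n.+1%:R^-1 * L) L; last first.
    rewrite le_eqVlt => /predU1P[e|]. 
      rewrite /F -e set_itv1 integral_set1 lee_fin mulr_ge0 ?invr_ge0 ?powR_ge0//; exact: ltW.
    by rewrite -[X in X < _]mul1r ltr_pM2r// ltNge invf_le1// ler1n.
  have cd r : n.+1%:R^-1 * L <= r -> is_derive r 1 G (r `^ s) /\ {for r, continuous (@powR R ^~ s)}.
    move=> Lr; have r0 : 0 < r by apply: lt_le_trans Lr; rewrite mulr_gt0// invr_gt0.
    by split; [exact: dG|exact: is_derive_continuous (is_derive_powR_gt0 s r0)].
  have cG r : n.+1%:R^-1 * L <= r -> {for r, continuous G}.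
    by move=> /cd [+ _]; exact: is_derive_continuous.
  rewrite (continuous_FTC2 (F := G) lt1).
  - rewrite -EFinB lee_fin lerBlDr lerDl mulr_ge0 ?invr_ge0 ?powR_ge0//; exact: ltW.
  - apply: continuous_in_subspaceT => r; rewrite inE/= in_itv/= => /andP[lr _].
    by have [] := cd _ lr.
  - split.
    + by move=> r; rewrite in_itv/= => /andP[/ltW /cd [/(@ex_derive _ _ _ _ _ _ _)]].
    + by apply: cvg_at_right_filter; exact: cG.
    + by apply: cvg_at_left_filter; apply: cG; exact: ltW.
  - move=> r; rewrite in_itv/= => /andP[/ltW /cd [+ _] _]; exact: is_derive1E.
apply/integrableP; split; first by apply/measurable_EFinP; exact: measurable_funTS.
have mF n : measurable (F n) by exact: measurable_itv.
have ndF : nondecreasing_seq F.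
  move=> m n mn; apply/subsetPset; apply: subset_itvr; rewrite bnd_simp.
  by rewrite ler_pM2r// lef_pV2 ?posrE// ler_nat.
have cv := @ge0_nondecreasing_set_cvg_integral _ (measurableTypeR R) R F (EFin \o (@powR R ^~ s)) lebesgue_measure ndF mF.
have lim : (\int[mu]_(r in \bigcup_n F n) (r `^ s)%:E <= (G L)%:E)%E.
  rewrite -(cvg_lim _ (cv _ _))//; last 2 first.
  - by move=> i; apply/measurable_EFinP; exact: measurable_funTS.
  - by move=> i r _; rewrite lee_fin powR_ge0.
  apply: lime_le; last exact: nearW.
  by apply: cvgP; apply: cv => [i|i r _]; [apply/measurable_EFinP; exact: measurable_funTS|rewrite lee_fin powR_ge0].
apply: (le_lt_trans _ (ltry (G L))); apply: (le_trans _ lim).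
under eq_integral => r _ do rewrite /= ger0_norm ?powR_ge0//.
apply: ge0_subset_integral => //.
- exact: bigcup_measurable.
- by apply/measurable_EFinP; exact: measurable_funTS.
- by move=> r _; rewrite lee_fin powR_ge0.
Qed.

Lemma integrable_powcos s tau (L : R) : -1 < s -> 0 < L ->
  mu.-integrable `]0, L[ (EFin \o powcos s tau).
Proof.
move=> s1 L0; apply: le_integrable (integrable_powR s1 L0) => //.
  apply/measurable_EFinP/measurable_funTS/measurable_funM => //.
  apply: measurableT_comp; last exact: measurable_funM.
  by apply: continuous_measurable_fun; exact: continuous_cos.
move=> r _; rewrite /powcos /= lee_fin normrM ler_piMr//.
by rewrite ler_norml cos_geN1 cos_le1.
Qed.

Lemma integrable_powsin s tau (L : R) : -1 < s -> 0 < L ->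
  mu.-integrable `]0, L[ (EFin \o powsin s tau).
Proof.
move=> s1 L0; apply: le_integrable (integrable_powR s1 L0) => //.
  apply/measurable_EFinP/measurable_funTS/measurable_funM => //.
  apply: measurableT_comp; last exact: measurable_funM.
  by apply: continuous_measurable_fun; exact: continuous_sin.
move=> r _; rewrite /powsin /= lee_fin normrM ler_piMr//.
by rewrite ler_norml sin_geN1 sin_le1.
Qed.

End PowerKernel.

(** * Conjugation by the weight *)

Section Conjugation.
Context {R : realType}.
Variables (a b : R).
Notation mu := (@lebesgue_measure R).
Implicit Types (f g w F G : R -> R[i]) (x : R).

Definition Cderivable f x := derivable (fRe f) x 1 /\ derivable (fIm f) x 1.

Lemma ReM (z1 z2 : R[i]) :
  complex.Re (z1 * z2) = complex.Re z1 * complex.Re z2 - complex.Im z1 * complex.Im z2.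
Proof. by case: z1 z2 => [? ?] [? ?]. Qed.

Lemma ImM (z1 z2 : R[i]) :
  complex.Im (z1 * z2) = complex.Re z1 * complex.Im z2 + complex.Im z1 * complex.Re z2.
Proof. by case: z1 z2 => [? ?] [? ?]. Qed.

Lemma derC_local f g x : a < x < b -> (forall y, a < y < b -> f y = g y) ->
  derC f x = derC g x.
Proof.
move=> axb fg; rewrite /derC !derive1E; congr (_ +i* _); apply: near_eq_derive;
  by apply: filterS (near_itvoo axb) => y ayb; rewrite /fRe /fIm fg.
Qed.

Lemma derCM f g x : Cderivable f x -> Cderivable g x ->
  derC (fun y => f y * g y) x = derC f x * g x + f x * derC g x.
Proof.
move=> [/derivableP f1 /derivableP f2] [/derivableP g1 /derivableP g2].
have -> : derC (fun y => f y * g y) x =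
    (fRe f x * derive1 (fRe g) x + fRe g x * derive1 (fRe f) x -
     (fIm f x * derive1 (fIm g) x + fIm g x * derive1 (fIm f) x)) +i*
    (fRe f x * derive1 (fIm g) x + fIm g x * derive1 (fRe f) x +
     (fIm f x * derive1 (fRe g) x + fRe g x * derive1 (fIm f) x)).
  rewrite /derC; congr (_ +i* _); rewrite !derive1E.
    rewrite (_ : fRe _ = (fRe f * fRe g - fIm f * fIm g)).
      exact: derive_val.
    by apply/funext => y; rewrite /fRe ReM.
  rewrite (_ : fIm _ = (fRe f * fIm g + fIm f * fRe g)).
    exact: derive_val.
  by apply/funext => y; rewrite /fIm ImM.
rewrite /derC /fRe /fIm; case: (f x) (g x) => [p q] [r s]; apply/eqP; rewrite eq_complex /=.
by apply/andP; split; apply/eqP; ring.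
Qed.

(** The inverse is the conjugate over the squared modulus [n], so both parts of the quotient are
    rational in the parts of [w] and [F]. *)
Lemma Cderivable_div F w x : w x != 0 -> Cderivable F x -> Cderivable w x ->
  Cderivable (fun y => (w y)^-1 * F y) x.
Proof.
move=> w0 [/derivableP F1 /derivableP F2] [/derivableP w1 /derivableP w2].
pose n y := fRe w y ^+ 2 + fIm w y ^+ 2.
have n0 : n x != 0.
  move: w0; rewrite /n /fRe /fIm; case: (w x) => [p q]; rewrite eq_complex /=.
  by apply: contra; rewrite paddr_eq0 ?sqr_ge0// !sqrf_eq0.
have dn : derivable n x 1 by exact: ex_derive.
have dV : derivable (fun y => (n y)^-1) x 1 by exact: derivableV.
move: dV => /derivableP dV.
have invE y : (w y)^-1 = (fRe w y * (n y)^-1) +i* (- (fIm w y * (n y)^-1)).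
  by rewrite /n /fRe /fIm; case: (w y).
split.
  rewrite (_ : fRe _ = ((fRe w * (fun y => (n y)^-1)) * fRe F + (fIm w * (fun y => (n y)^-1)) * fIm F)).
    exact: ex_derive.
  apply/funext => y; rewrite /fRe ReM invE /=.
  by rewrite mulNr opprK.
rewrite (_ : fIm _ = ((fRe w * (fun y => (n y)^-1)) * fIm F - (fIm w * (fun y => (n y)^-1)) * fRe F)).
  exact: ex_derive.
apply/funext => y; rewrite /fIm ImM invE /=.
by rewrite mulNr.
Qed.

Hypothesis ab : a < b.
Variable w : R -> R[i].
Hypothesis w0 : forall x, a < x < b -> w x != 0.

(** The product rule is applied to [F = w G], which avoids an explicit formula for the derivative of
    the reciprocal of [w]. *)
Lemma wdiff_conj F G x : a < x < b -> (forall y, a < y < b -> G y = (w y)^-1 * F y) ->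
  Cderivable F x -> Cderivable w x -> wdiff w G x = (w x)^-1 * derC F x.
Proof.
move=> axb GE dF dw; have dG := Cderivable_div (w0 axb) dF dw.
rewrite /wdiff (derC_local axb GE) (GE _ axb).
rewrite (@derC_local F (fun y => w y * ((w y)^-1 * F y)) x axb); last first.
  by move=> y ayb; rewrite mulVKf// w0.
rewrite (derCM dw dG) mulrDr mulKf ?w0// [RHS]addrC; congr (_ + _).
by rewrite [RHS]mulrA; congr (_ * _); exact: mulrC.
Qed.

(** Differentiability of [w] is asked only when [0 < m], since for [m = 0] the weight may be merely
    absolutely continuous. *)
Lemma iter_wdiff_conj m F G :
  (forall k x, (k < m)%N -> a < x < b -> Cderivable (iter k derC F) x) ->
  ((0 < m)%N -> forall x, a < x < b -> Cderivable w x) ->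
  (forall x, a < x < b -> G x = (w x)^-1 * F x) ->
  forall x, a < x < b -> iter m (wdiff w) G x = (w x)^-1 * iter m derC F x.
Proof.
elim: m => [//|m ih] dF dw GE x axb; rewrite !iterS.
apply: wdiff_conj => //; [|exact: dF|exact: dw].
by apply: ih => // [k y km|m0]; [exact/dF/ltnW|exact: dw].
Qed.

Lemma fRe_iter_derC k f : fRe (iter k derC f) = iter k (@derive1 R R) (fRe f).
Proof. by elim: k => // k ih; rewrite !iterS -ih. Qed.

Lemma fIm_iter_derC k f : fIm (iter k derC f) = iter k (@derive1 R R) (fIm f).
Proof. by elim: k => // k ih; rewrite !iterS -ih. Qed.

Definition Cnder P n f := nder a b P n (fRe f) /\ nder a b P n (fIm f).

Lemma Cnder_iter P n f : local_prop a b P -> Cnder P n f ->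
  [/\ P (fRe (iter n derC f)), P (fIm (iter n derC f)) &
    forall k x, (k < n)%N -> a < x < b -> Cderivable (iter k derC f) x].
Proof.
move=> lP [n1 n2]; have [P1 d1] := nder_iter lP n1; have [P2 d2] := nder_iter lP n2.
split; rewrite ?fRe_iter_derC ?fIm_iter_derC// => k x kn axb.
by rewrite /Cderivable fRe_iter_derC fIm_iter_derC; split; [exact: d1|exact: d2].
Qed.

Lemma CnderM P n f g :
  (forall f g : R -> R, (forall x, a < x < b -> is_derive x 1 f (g x)) -> P g -> P f) ->
  (forall f g : R -> R, P f -> P g -> P (fun x => f x + g x)) ->
  (forall (c : R) (f : R -> R), P f -> P (fun x => c * f x)) ->
  (forall f g : R -> R, P f -> P g -> P (fun x => f x * g x)) ->
  Cnder P n f -> Cnder P n g -> Cnder P n (mulop f g).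
Proof.
move=> PS PD PZ PM [f1 f2] [g1 g2]; split.
  rewrite (_ : fRe _ = fun x => fRe f x * fRe g x + -1 * (fIm f x * fIm g x)).
    by apply: nderD => //; [exact: nderM|apply: nderZ; [exact: PZ|exact: nderM]].
  by apply/funext => x; rewrite /fRe /mulop ReM mulN1r.
rewrite (_ : fIm _ = fun x => fRe f x * fIm g x + fIm f x * fRe g x).
  by apply: nderD => //; exact: nderM.
by apply/funext => x; rewrite /fIm /mulop ImM.
Qed.

(** The complex integral splits into four real convolutions, of [powcos] and [powsin] with the two
    parts of [F]. Both kernels are integrable near 0 since [s > -1], so [conv_regular] applies to
    each. *)
Lemma RLint_regular (beta : R[i]) n F : 0 < complex.Re beta -> Cnder (ACoo a b) n F ->
  Cnder (ae_derivable a b) n (RLint a beta F).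
Proof.
move=> beta0 [F1 F2].
pose s := complex.Re (beta - 1); pose tau := complex.Im (beta - 1).
have sE : s = complex.Re beta - 1 by rewrite /s; case: (beta).
have s1 : -1 < s by rewrite sE; lra.
have L0 : 0 < b - a by rewrite subr_gt0.
have ic := integrable_powcos tau s1 L0; have is_ := integrable_powsin tau s1 L0.
have nc m := (nder_powcos_powsin a b s tau m).1; have ns m := (nder_powcos_powsin a b s tau m).2.
have [nc1 _ ic1] := conv_regular ab ic nc F1; have [nc2 _ ic2] := conv_regular ab ic nc F2.
have [ns1 _ is1] := conv_regular ab is_ ns F1; have [ns2 _ is2] := conv_regular ab is_ ns F2.
pose c1 := convolution a (powcos s tau) (fRe F); pose c2 := convolution a (powcos s tau) (fIm F).
pose s1' := convolution a (powsin s tau) (fRe F); pose s2' := convolution a (powsin s tau) (fIm F).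
pose p := complex.Re (GammaC beta)^-1; pose q := complex.Im (GammaC beta)^-1.
have intE x : a < x < b -> intC `]a, x[ (fun t => powC (x - t) (beta - 1) * F t) =
    (c1 x - s2' x) +i* (c2 x + s1' x).
  move=> axb; rewrite /intC; congr (_ +i* _).
    rewrite -RintegralB//; [|exact: ic1|exact: is2].
    by apply: eq_Rintegral => t _; rewrite /fRe ReM /powC ReM ImM /= !mul0r subr0 addr0.
  rewrite -RintegralD//; [|exact: ic2|exact: is1].
  by apply: eq_Rintegral => t _; rewrite /fIm ImM /powC ReM ImM /= !mul0r subr0 addr0.
have nD := @nderD R a b (ae_derivable a b) n _ _ (@ae_derivableD R a b).
have nZ c := @nderZ R a b (ae_derivable a b) n c _ (@ae_derivableZ R a b c).
split.
  apply: (@nder_local R a b _ n (@ae_derivable_local R a b) (fun x => p * (c1 x + -1 * s2' x) + - q * (c2 x + s1' x))).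
  - by move=> x axb; rewrite /fRe /RLint intE// ReM -/p -/q /=; ring.
  - by apply: (nD); apply: (nZ); apply: (nD) => //; apply: (nZ).
apply: (@nder_local R a b _ n (@ae_derivable_local R a b) (fun x => p * (c2 x + s1' x) + q * (c1 x + -1 * s2' x))).
- by move=> x axb; rewrite /fIm /RLint intE// ImM -/p -/q /=; ring.
- by apply: (nD); apply: (nZ); apply: (nD) => //; apply: (nZ).
Qed.

End Conjugation.

(** * From the function spaces of the statement to iterated derivatives *)

Section FunctionClasses.
Context {R : realType}.
Variables (a b : R).
Hypothesis ab : a < b.
Variable (A : set R).
Hypothesis abA : `]a, b[ `<=` A.

Lemma derivs_on_sub n (f : R -> R) d : derivs_on A n f d -> derivs_on `]a, b[ n f d.
Proof.
move=> [df dd]; split=> [x xab|k kn x xab]; first exact/df/abA.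
apply: (cvg_trans _ (dd k kn x (abA xab))).
by move=> P; rewrite !nbhs_simpl /within/=; apply: filterS => y yP /abA; exact: yP.
Qed.

Lemma abs_cont_sub (f : R -> R) : abs_cont A f -> abs_cont `]a, b[ f.
Proof.
move=> fA e /fA[d d0 hd]; exists d => // m s t st; apply: hd => i.
by have [sti stA] := st i; split => //; exact: subset_trans stA abA.
Qed.

Lemma ACnC_Cnder n (f : R -> R[i]) : ACnC n.+1 A f -> Cnder a b (ACoo a b) n f.
Proof.
by move=> [[d1 /derivs_on_sub fd1 /abs_cont_sub dA1] [d2 /derivs_on_sub fd2 /abs_cont_sub dA2]];
  split; [apply: derivs_on_nder fd1 dA1|apply: derivs_on_nder fd2 dA2]; exact: ACoo_local.
Qed.

Lemma CnC_Cnder n (f : R -> R[i]) : CnC n A f -> Cnder a b (fun=> True) n f.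
Proof.
by move=> [[d1 /derivs_on_sub fd1 _] [d2 /derivs_on_sub fd2 _]];
  split; [apply: derivs_on_nder fd1 _|apply: derivs_on_nder fd2 _].
Qed.

(** Descending through primitives, [f] itself is absolutely continuous, hence a constant plus the
    integral of a density. *)
Lemma nder_ACoo_ae_derivable n (f : R -> R) : nder a b (ACoo a b) n f -> ae_derivable a b f.
Proof.
move=> nf; have fA : abs_cont `]a, b[ f.
  elim: n f nf => [//|n ih f [f' ff' /ih f'A]]; exact: ACoo_primitive ff' f'A.
have [H HT fH] := abs_cont_extend ab fA; have [g ig gE] := abs_cont_density a b HT.
have igI : (@lebesgue_measure R).-integrable `]a, b[ (EFin \o g) by apply: integrableS ig.
have [aeG _ _] := primitive_regular ab igI
  (fun x _ => erefl (\int[lebesgue_measure]_(t in `]a, x]) g t)).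
have aeGH : ae_derivable a b (fun x => \int[lebesgue_measure]_(t in `]a, x]) g t + H a).
  apply: (ae_derivableD aeG); apply: aeW => x _; exact: derivable_cst.
have fE x : a < x < b -> \int[lebesgue_measure]_(t in `]a, x]) g t + H a = f x.
  by move=> axb; rewrite fH ?in_itv// -gE ?subrK//; lra.
exact: (ae_derivable_local fE aeGH).
Qed.

End FunctionClasses.

Lemma wRLintE (R : realType) (a : R) (alpha : R[i]) (w f : R -> R[i]) x :
  wRLint a alpha w f x = (w x)^-1 * RLint a alpha (mulop w f) x.
Proof.
rewrite /wRLint /RLint invfM [X in X * _ = _]mulrC -mulrA; congr (_ * (_ * _)).
by congr (intC _ _); apply/funext => t; rewrite /mulop mulrA.
Qed.

Lemma frac_ord_sub_gt0 (R : realType) (alpha : R[i]) :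
  0 < complex.Re ((frac_ord alpha)%:R - alpha).
Proof.
rewrite -(rmorph_nat (real_complex R)); case: alpha => p q /=.
by rewrite subr_gt0 /frac_ord/= truncnS_gt.
Qed.

(** * The three conjugation identities *)

Unset Implicit Arguments.
Set Strict Implicit.

Theorem proposition3p1 (R : realType) (a b : R) (hab : a < b)
    (w : R -> R[i]) (hw : forall x, a < x < b -> w x != 0) (alpha : R[i]) :
  (0 < complex.Re alpha -> LinftyC `]a, b[ w ->
    forall f : R -> R[i], L1C `]a, b[ f ->
    forall x, a < x < b ->
      wRLint a alpha w f x = (mulop_inv w \o RLint a alpha \o mulop w) f x)
  /\
  (0 <= complex.Re alpha -> ACnC (frac_ord alpha) `[a, b] w ->
    forall f : R -> R[i], ACnC (frac_ord alpha) `]a, b[ f ->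
    {ae lebesgue_measure, forall x : R, a < x < b ->
      wRLder a alpha w f x = (mulop_inv w \o RLder a alpha \o mulop w) f x})
  /\
  (0 <= complex.Re alpha -> CnC (frac_ord alpha) `[a, b] w ->
    forall f : R -> R[i], CnC (frac_ord alpha) `]a, b[ f ->
    forall x, a < x < b ->
      wCder a alpha w f x = (mulop_inv w \o Cder a alpha \o mulop w) f x).

Proof.
split; [|split].
- by move=> _ _ f _ x _; rewrite wRLintE.
- move=> alpha0 wA f fA.
  (* The first [m] derivatives exist at every point of []a, b[]; only the last one is confined to
     almost every point. *)
  pose m := (frac_ord alpha).-1.
  have sub : `]a, b[ `<=` `[a, b] by exact: subset_itv_oo_cc.
  have wn := ACnC_Cnder sub (wA : ACnC m.+1 _ _).
  have fn := ACnC_Cnder (@subset_refl _ _) (fA : ACnC m.+1 _ _).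
  have wfn : Cnder a b (ACoo a b) m (mulop w f).
    apply: CnderM wn fn.
    + by move=> g g'; exact: ACoo_primitive.
    + by move=> g g'; exact: ACooD.
    + move=> c g gA; apply: (abs_cont_dominated (C := `|c|) gA gA) => x y _ _.
      by rewrite -mulrBr normrM ler_wpM2l// lerDl.
    + by move=> g g'; exact: ACooM.
  have Fn := RLint_regular hab (frac_ord_sub_gt0 alpha) wfn.
  have [ae1 ae2 dF] := Cnder_iter (@ae_derivable_local R a b) Fn.
  have aw1 := nder_ACoo_ae_derivable hab wn.1; have aw2 := nder_ACoo_ae_derivable hab wn.2.
  have dw : (0 < m)%N -> forall x, a < x < b -> Cderivable w x.
    move=> m0 x axb; have [_ _ /(_ 0%N x m0 axb)] := Cnder_iter (@ACoo_local R a b) wn.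
    exact.
  have FF := ae_filter_ringOfSetsType (@lebesgue_measure R).
  (* The exceptional null set collects the points where a part of the [m]-th derivative of the
     fractional integral, or a part of [w], fails to be differentiable. *)
  apply: (@filterS2 _ _ FF _ _ _ _ (@filterI _ _ FF _ _ ae1 ae2) (@filterI _ _ FF _ _ aw1 aw2)).
  move=> x /= [F1 F2] [w1 w2] axb.
  (* The outermost derivative is split off: [iter_wdiff_conj] handles the inner [m] on all of []a,
     b[], and [wdiff_conj] the last one at [x]. *)
  change (wdiff w (iter m (wdiff w) (wRLint a ((frac_ord alpha)%:R - alpha) w f)) x =
    (w x)^-1 * derC (iter m derC (RLint a ((frac_ord alpha)%:R - alpha) (mulop w f))) x).
  apply: (wdiff_conj hw axb).
  + by move=> y ayb; apply: (iter_wdiff_conj hw dF dw _ ayb) => z azb; exact: wRLintE.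
  + by split; [exact: F1|exact: F2].
  + by split; [exact: w1|exact: w2].
- move=> alpha0 wC f fC x axb; have sub : `]a, b[ `<=` `[a, b] by exact: subset_itv_oo_cc.
  have wn := CnC_Cnder sub wC; have fn := CnC_Cnder (@subset_refl _ _) fC.
  have wfn : Cnder a b (fun=> True) (frac_ord alpha) (mulop w f) by exact: CnderM wn fn.
  have [_ _ dwf] := Cnder_iter (fun f g _ _ => I) wfn.
  have [_ _ dw] := Cnder_iter (fun f g _ _ => I) wn.
  rewrite /wCder /Cder /= /mulop_inv wRLintE; congr (_ * (_ * _)).
  (* The integral sees only [t] in []a, x[], where the iterated conjugation, multiplied by [w],
     identifies the integrands. *)
  have eqI t : a < t < x -> mulop w (iter (frac_ord alpha) (wdiff w) f) t =
      iter (frac_ord alpha) derC (mulop w f) t.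
    move=> atx; have atb : a < t < b by lra.
    rewrite /mulop (iter_wdiff_conj (F := mulop w f) hw dwf _ _ atb).
    + by rewrite mulVKf// hw.
    + by move=> n0 y ayb; exact: (dw 0%N).
    + by move=> y ayb; rewrite /mulop mulKf// hw.
  by rewrite /intC; congr (_ +i* _); apply: eq_Rintegral => t; rewrite inE/= in_itv/= => atx;
    rewrite /fRe /fIm eqI.
Qed.
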